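(* Let $\mathbb K$ be a field of characteristic different from $2$, let $s\ge 0$ be an integer, let $(g_{\lambda\mu})$ be the matrix of a nondegenerate symmetric bilinear form on $\mathbb K^{s+1}$, with inverse matrix $(g^{\lambda\mu})$, and let $E=\bigoplus_{\lambda=0}^{s}\mathbb K\nabla_\lambda$ be the vector space with basis $\nabla_0,\dots,\nabla_s$. For $\rho\in\{0,\dots,s\}$ put $$W^\rho=(g^{\rho\lambda}g^{\mu\nu}+g^{\rho\nu}g^{\lambda\mu}-2g^{\rho\mu}g^{\lambda\nu})\,\nabla_\lambda\otimes\nabla_\mu\otimes\nabla_\nu\in E^{\otimes 3},$$ and let $R\subset E^{\otimes 3}$ be the linear span of $W^0,\dots,W^s$. Let $\varphi:R\to \mathbb K 1\oplus E\oplus E^{\otimes 2}$ be a linear map and write, for each $\rho\in\{0,\dots,s\}$, $$\varphi(W^\rho)=j^{\mu\nu\rho}\,\nabla_\mu\otimes\nabla_\nu+j^{\lambda\rho}\,\nabla_\lambda+j^\rho\, 1,\qquad j^{\mu\nu\rho},\,j^{\lambda\rho},\,j^\rho\in\mathbb K.$$ Then the algebra $\mathcal A_\varphi=T(E)/(\{x-\varphi(x)\mid x\in R\})$ satisfies the PBW property if and only if there exist $b_\rho,\ \omega^{\alpha\beta\gamma},\ s^{\alpha\beta\gamma},\ s^{\alpha\beta},\ s^\alpha\in\mathbb K$ (indices in $\{0,\dots,s\}$) such that $\omega^{\alpha\beta\gamma}$ is completely antisymmetric (that is, $\omega\in\wedge^3\mathbb K^{s+1}$), $s^{\alpha\beta\gamma}$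 is completely symmetric with $s^{\alpha\beta\rho}b_\rho=0$, $s^{\alpha\beta}$ is symmetric with $s^{\alpha\rho}b_\rho=0$, $s^\alpha$ satisfies $s^\rho b_\rho=0$, and for all $\alpha,\beta,\gamma\in\{0,\dots,s\}$ $$\begin{array}{lll} j^{\alpha\beta\gamma}&=&(g^{\alpha\rho}g^{\beta\gamma}-g^{\alpha\gamma}g^{\beta\rho})b_\rho+\omega^{\alpha\beta\gamma}+s^{\alpha\beta\gamma},\\ j^{\alpha\beta}&=&-\tfrac12\,\omega^{\alpha\beta\rho}b_\rho+s^{\alpha\beta},\\ j^\alpha&=&s^\alpha.\end{array}$$
   Context: Summation over repeated upper-lower indices (running over $\{0,\dots,s\}$) is understood. $T(E)$ is the tensor algebra of $E$ over $\mathbb K$, and $(X)$ denotes the two-sided ideal generated by a subset $X\subset T(E)$. The relations $W^\rho=0$ define the cubic Yang-Mills algebra $\mathcal A=T(E)/(R)$; equivalently these are the relations $g^{\lambda\mu}[\nabla_\lambda,[\nabla_\mu,\nabla_\nu]]=0$ for $\nu\in\{0,\dots,s\}$. It is graded with each $\nabla_\lambda$ in degree $1$. PBW property: let $F^n=\bigoplus_{0\le i\le n}E^{\otimes i}$ be the natural filtration of $T(E)$. The algebra $\mathcal A_\varphi$ is filtered by the images of the $F^n$; let $gr(\mathcal A_\varphi)$ be the associated graded algebra. There is a canonical surjective graded algebra homomorphism $\mathcal A\to gr(\mathcal A_\varphi)$ sending each generator $\nabla_\lambda$ to its class in degree $1$. One says that $\mathcal A_\varphi$ satisfies the PBW property if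 this homomorphism is an isomorphism. *)

(* Defs.v *)
From HB Require Import structures.
From mathcomp Require Import all_boot all_algebra generic_quotient.
From mathcomp Require Import finmap boolp monalg.

Set Implicit Arguments.
Unset Strict Implicit.
Unset Printing Implicit Defensive.

Import GRing.Theory.

Local Open Scope ring_scope.
Local Open Scope quotient_scope.

(* Associative unital K-algebras in which 1 = 0 is allowed: a quotient of the
   tensor algebra may be zero, whereas [lalgType] and [algType] require
   1 != 0. The hierarchy has no join of [pzRingType] and [lmodType], so the
   scaling is a field of the structure, and [*:] is recovered from it. *)
HB.mixin Record isPzAlg (K : pzRingType) A of GRing.PzRing A := {
  pzscale : K -> A -> A;
  pzscaleA : forall a b v, pzscale a (pzscale b v) = pzscale (a * b) v;
  pzscale1 : left_id 1 pzscale;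
  pzscaleDr : right_distributive pzscale +%R;
  pzscaleDl : forall v, {morph pzscale^~ v : a b / a + b};
  pzscaleAl : forall k x y, pzscale k (x * y) = pzscale k x * y;
  pzscaleAr : forall k x y, pzscale k (x * y) = x * pzscale k y
}.

#[short(type="pzAlgType")]
HB.structure Definition PzAlg (K : pzRingType) :=
  {A of GRing.PzRing A & isPzAlg K A}.

HB.factory Record Lmodule_isPzAlg (K : pzRingType) A
    of GRing.PzRing A & GRing.Lmodule K A := {
  pzscalerAl : forall (k : K) (x y : A), k *: (x * y) = (k *: x) * y;
  pzscalerAr : forall (k : K) (x y : A), k *: (x * y) = x * (k *: y)
}.

HB.builders Context K A of Lmodule_isPzAlg K A.
HB.instance Definition _ := isPzAlg.Build K A
  (@scalerA K A) (@scale1r K A) (@scalerDr K A) (fun v a b => scalerDl v a b)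
  pzscalerAl pzscalerAr.
HB.end.

HB.instance Definition _ (K : pzRingType) (A : pzAlgType K) :=
  GRing.Zmodule_isLmodule.Build K (PzAlg.sort A)
    (@pzscaleA K A) (@pzscale1 K A) (@pzscaleDr K A) (@pzscaleDl K A).

Lemma pzscalerAl (K : pzRingType) (A : pzAlgType K) (k : K) (x y : A) :
  k *: (x * y) = (k *: x) * y.
Proof. exact: pzscaleAl. Qed.

Lemma pzscalerAr (K : pzRingType) (A : pzAlgType K) (k : K) (x y : A) :
  k *: (x * y) = x * (k *: y).
Proof. exact: pzscaleAr. Qed.

Section Ideals.
Variable A : pzRingType.

Definition two_sided_ideal (I : A -> Prop) : Prop :=
  [/\ I 0, forall x y, I x -> I y -> I (x + y)
    & forall a x b, I x -> I (a * x * b)].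

Record ideal := Ideal {
  ideal_mem :> A -> Prop;
  idealP : two_sided_ideal ideal_mem
}.

Definition gen_mem (X : A -> Prop) (x : A) : Prop :=
  forall I : A -> Prop,
    two_sided_ideal I -> (forall y, X y -> I y) -> I x.

Lemma gen_memP X : two_sided_ideal (gen_mem X).
Proof.
split=> [I [] //|x y hx hy I hI hX|a x b hx I hI hX].
  by have [_ hD _] := hI; apply: hD; [apply: hx|apply: hy].
by have [_ _ hM] := hI; apply: hM; apply: hx.
Qed.

Definition gen_ideal X : ideal := Ideal (gen_memP X).

Variable I : ideal.

Definition idealb : {pred A} := fun x => `[< I x >].

Lemma idealbE x : (x \in idealb) = `[< I x >]. Proof. by []. Qed.

Lemma idealb_zmod : zmod_closed idealb.
Proof.
have [h0 hD hM] := idealP I.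
split=> [|x y]; rewrite !idealbE; first exact/asboolP.
move=> /asboolP hx /asboolP hy; apply/asboolP; apply: hD => //.
by have := hM (-1) y 1 hy; rewrite mulr1 mulN1r.
Qed.

HB.instance Definition _ := GRing.isZmodClosed.Build A idealb idealb_zmod.

Lemma idealbMl a x : x \in idealb -> a * x \in idealb.
Proof.
have [_ _ hM] := idealP I; rewrite !idealbE => /asboolP hx; apply/asboolP.
by have := hM a x 1 hx; rewrite mulr1.
Qed.

Lemma idealbMr a x : x \in idealb -> x * a \in idealb.
Proof.
have [_ _ hM] := idealP I; rewrite !idealbE => /asboolP hx; apply/asboolP.
by have := hM 1 x a hx; rewrite mul1r.
Qed.

End Ideals.

Section QuotientAlgebra.
Variables (K : pzRingType) (A : pzAlgType K) (I : ideal A).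

Definition quot_alg : Type := {ideal_quot (idealb I)}.

HB.instance Definition _ := GRing.Zmodule.on quot_alg.

Definition quot_pi (x : A) : quot_alg := \pi_({ideal_quot (idealb I)}) x.
Definition quot_repr (x : quot_alg) : A :=
  @repr _ {ideal_quot (idealb I)} x.

Lemma quot_reprK x : quot_pi (quot_repr x) = x.
Proof. exact: reprK. Qed.

Lemma quot_eqP x y : reflect (quot_pi x = quot_pi y) (x - y \in idealb I).
Proof. by rewrite Quotient.idealrBE; apply: eqP. Qed.

Lemma quot_piK x : x - quot_repr (quot_pi x) \in idealb I.
Proof. by apply/quot_eqP; rewrite quot_reprK. Qed.

Lemma quot_piD : {morph quot_pi : x y / x + y}.
Proof. exact: raddfD. Qed.

Definition quot_one : quot_alg := quot_pi 1.
Definition quot_mul (x y : quot_alg) : quot_alg :=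
  quot_pi (quot_repr x * quot_repr y).
Definition quot_scale (k : K) (x : quot_alg) : quot_alg :=
  quot_pi (k *: quot_repr x).

Lemma quot_piM x y : quot_pi (x * y) = quot_mul (quot_pi x) (quot_pi y).
Proof.
apply/quot_eqP; set x' := quot_repr _; set y' := quot_repr _.
have -> : x * y - x' * y' = (x - x') * y + x' * (y - y').
  by rewrite mulrBl mulrBr addrA subrK.
by apply: rpredD; [apply: idealbMr | apply: idealbMl]; apply: quot_piK.
Qed.

Lemma idealbZ k x : x \in idealb I -> k *: x \in idealb I.
Proof. by move=> xI; rewrite -[x]mul1r pzscalerAl idealbMl. Qed.

Lemma quot_piZ k x : quot_pi (k *: x) = quot_scale k (quot_pi x).
Proof. by apply/quot_eqP; rewrite -scalerBr idealbZ ?quot_piK. Qed.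

Lemma quot_mulA : associative quot_mul.
Proof.
move=> x y z; rewrite -[x]quot_reprK -[y]quot_reprK -[z]quot_reprK.
by rewrite -!quot_piM mulrA.
Qed.

Lemma quot_mul1 : left_id quot_one quot_mul.
Proof. by move=> x; rewrite -[x]quot_reprK -quot_piM mul1r. Qed.

Lemma quot_mulr1 : right_id quot_one quot_mul.
Proof. by move=> x; rewrite -[x]quot_reprK -quot_piM mulr1. Qed.

Lemma quot_mulDl : left_distributive quot_mul +%R.
Proof.
move=> x y z; rewrite -[x]quot_reprK -[y]quot_reprK -[z]quot_reprK.
by rewrite -quot_piD -!quot_piM -quot_piD mulrDl.
Qed.

Lemma quot_mulDr : right_distributive quot_mul +%R.
Proof.
move=> x y z; rewrite -[x]quot_reprK -[y]quot_reprK -[z]quot_reprK.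
by rewrite -quot_piD -!quot_piM -quot_piD mulrDr.
Qed.

HB.instance Definition _ := GRing.Zmodule_isPzRing.Build quot_alg
  quot_mulA quot_mul1 quot_mulr1 quot_mulDl quot_mulDr.

Lemma quot_scaleA a b v :
  quot_scale a (quot_scale b v) = quot_scale (a * b) v.
Proof. by rewrite -[v]quot_reprK -!quot_piZ scalerA. Qed.

Lemma quot_scale1 : left_id 1 quot_scale.
Proof. by move=> v; rewrite -[v]quot_reprK -quot_piZ scale1r. Qed.

Lemma quot_scaleDr : right_distributive quot_scale +%R.
Proof.
move=> a u v; rewrite -[u]quot_reprK -[v]quot_reprK.
by rewrite -quot_piD -!quot_piZ -quot_piD scalerDr.
Qed.

Lemma quot_scaleDl v : {morph quot_scale^~ v : a b / a + b}.
Proof.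
by move=> a b; rewrite -[v]quot_reprK -!quot_piZ -quot_piD scalerDl.
Qed.

Lemma quot_scaleAl k x y :
  quot_scale k (quot_mul x y) = quot_mul (quot_scale k x) y.
Proof.
rewrite -[x]quot_reprK -[y]quot_reprK; move: (quot_repr x) => {}x.
by rewrite -quot_piM -!quot_piZ -quot_piM pzscalerAl.
Qed.

Lemma quot_scaleAr k x y :
  quot_scale k (quot_mul x y) = quot_mul x (quot_scale k y).
Proof.
rewrite -[x]quot_reprK -[y]quot_reprK.
by rewrite -quot_piM -!quot_piZ -quot_piM pzscalerAr.
Qed.

HB.instance Definition _ := GRing.Zmodule_isLmodule.Build K quot_alg
  quot_scaleA quot_scale1 quot_scaleDr quot_scaleDl.
HB.instance Definition _ := Lmodule_isPzAlg.Build K quot_alg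
  quot_scaleAl quot_scaleAr.

Lemma quot_pi_additive : zmod_morphism quot_pi.
Proof. exact: raddfB. Qed.

HB.instance Definition _ :=
  GRing.isZmodMorphism.Build A quot_alg quot_pi quot_pi_additive.

Lemma quot_pi_monoid : monoid_morphism quot_pi.
Proof. by split=> // x y; rewrite quot_piM. Qed.

HB.instance Definition _ :=
  GRing.isMonoidMorphism.Build A quot_alg quot_pi quot_pi_monoid.

HB.instance Definition _ :=
  GRing.isScalable.Build K A quot_alg *:%R quot_pi quot_piZ.

End QuotientAlgebra.

Record filtration (K : pzRingType) (B : pzAlgType K) := Filtration {
  fil :> nat -> {pred B};
  fil_submod : forall n, submod_closed (fil n);
  filS : forall n, {subset fil n <= fil n.+1};
  fil_one : 1 \in fil 0%N;
  filM : forall m n x y,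
    x \in fil m -> y \in fil n -> x * y \in fil (m + n)%N
}.

Section FiltrationPieces.
Variables (K : pzRingType) (B : pzAlgType K) (F : filtration B) (n : nat).

HB.instance Definition _ :=
  GRing.isSubmodClosed.Build K B (F n) (fil_submod F n).

Record fil_piece := FilPiece { fil_val :> B; _ : fil_val \in F n }.

HB.instance Definition _ := [isSub for fil_val].
HB.instance Definition _ := [Choice of fil_piece by <:].
HB.instance Definition _ := [SubChoice_isSubLmodule of fil_piece by <:].

End FiltrationPieces.

(* [series B] is B^nat with the Cauchy product, in which t stands for the
   sequence (0, 1, 0, 0, ...). *)
Definition series (B : Type) : Type := nat -> B.

HB.instance Definition _ (B : Type) := gen_eqMixin (series B).
HB.instance Definition _ (B : Type) := gen_choiceMixin (series B).

Section Series.
Variables (K : pzRingType) (B : pzAlgType K).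
Implicit Types f g h : series B.

Definition ser0 : series B := fun=> 0.
Definition ser_add f g : series B := fun n => f n + g n.
Definition ser_opp f : series B := fun n => - f n.
Definition ser1 : series B := fun n => (n == 0%N)%:R.
Definition ser_mul f g : series B :=
  fun n => \sum_(i < n.+1) f i * g (n - i)%N.
Definition ser_scale (k : K) f : series B := fun n => k *: f n.

Lemma ser_addA : associative ser_add.
Proof. by move=> f g h; apply/funext=> n; apply: addrA. Qed.

Lemma ser_addC : commutative ser_add.
Proof. by move=> f g; apply/funext=> n; apply: addrC. Qed.

Lemma ser_add0 : left_id ser0 ser_add.
Proof. by move=> f; apply/funext=> n; apply: add0r. Qed.

Lemma ser_addN : left_inverse ser0 ser_opp ser_add.
Proof. by move=> f; apply/funext=> n; apply: addNr. Qed.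

HB.instance Definition _ := GRing.isZmodule.Build (series B)
  ser_addA ser_addC ser_add0 ser_addN.

Lemma ser_mul_rev f g n :
  ser_mul f g n = \sum_(i < n.+1) f (n - i)%N * g i.
Proof.
rewrite /ser_mul (reindex_inj rev_ord_inj) /=.
by apply: eq_bigr => i _; rewrite (sub_ordK i).
Qed.

Lemma ser_mulA : associative ser_mul.
Proof.
move=> p q r; apply/funext=> i; rewrite [RHS]ser_mul_rev /ser_mul.
pose coef3 j k := p j * (q (i - j - k)%N * r k).
transitivity (\sum_(j < i.+1) \sum_(k < i.+1 | (k <= i - j)%N) coef3 j k).
  apply: eq_bigr => /= j _; rewrite -/(ser_mul q r _) ser_mul_rev big_distrr /=.
  by rewrite (big_ord_narrow_leq (leq_subr _ _)).
rewrite (exchange_big_dep predT) //=; apply: eq_bigr => k _.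
transitivity (\sum_(j < i.+1 | (j <= i - k)%N) coef3 j k).
  apply: eq_bigl => j; rewrite -ltnS -(ltnS j) -!subSn ?leq_ord //.
  by rewrite -subn_gt0 -(subn_gt0 j) -!subnDA addnC.
rewrite (big_ord_narrow_leq (leq_subr _ _)) big_distrl /=.
by apply: eq_bigr => j _; rewrite /coef3 -!subnDA addnC mulrA.
Qed.

Lemma ser_mul1 : left_id ser1 ser_mul.
Proof.
move=> f; apply/funext=> n; rewrite /ser_mul big_ord_recl subn0 mul1r.
by rewrite big1 ?addr0 // => j _; rewrite /ser1 mul0r.
Qed.

Lemma ser_mulr1 : right_id ser1 ser_mul.
Proof.
move=> f; apply/funext=> n; rewrite ser_mul_rev big_ord_recl subn0 mulr1.
by rewrite big1 ?addr0 // => j _; rewrite /ser1 mulr0.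
Qed.

Lemma ser_mulDl : left_distributive ser_mul +%R.
Proof.
move=> f g h; apply/funext=> n.
transitivity (ser_mul f h n + ser_mul g h n) => //.
by rewrite -big_split; apply: eq_bigr => i _; apply: mulrDl.
Qed.

Lemma ser_mulDr : right_distributive ser_mul +%R.
Proof.
move=> f g h; apply/funext=> n.
transitivity (ser_mul f g n + ser_mul f h n) => //.
by rewrite -big_split; apply: eq_bigr => i _; apply: mulrDr.
Qed.

HB.instance Definition _ := GRing.Zmodule_isPzRing.Build (series B)
  ser_mulA ser_mul1 ser_mulr1 ser_mulDl ser_mulDr.

Lemma ser_scaleA a b f : ser_scale a (ser_scale b f) = ser_scale (a * b) f.
Proof. by apply/funext=> n; apply: scalerA. Qed.

Lemma ser_scale1 : left_id 1 ser_scale.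
Proof. by move=> f; apply/funext=> n; apply: scale1r. Qed.

Lemma ser_scaleDr : right_distributive ser_scale +%R.
Proof. by move=> a f g; apply/funext=> n; apply: scalerDr. Qed.

Lemma ser_scaleDl f : {morph ser_scale^~ f : a b / a + b}.
Proof. by move=> a b; apply/funext=> n; apply: scalerDl. Qed.

Lemma ser_scaleAl k f g :
  ser_scale k (ser_mul f g) = ser_mul (ser_scale k f) g.
Proof.
apply/funext=> n; rewrite /ser_scale /ser_mul scaler_sumr.
by apply: eq_bigr => i _; rewrite -pzscalerAl.
Qed.

Lemma ser_scaleAr k f g :
  ser_scale k (ser_mul f g) = ser_mul f (ser_scale k g).
Proof.
apply/funext=> n; rewrite /ser_scale /ser_mul scaler_sumr.
by apply: eq_bigr => i _; rewrite -pzscalerAr.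
Qed.

HB.instance Definition _ := GRing.Zmodule_isLmodule.Build K (series B)
  ser_scaleA ser_scale1 ser_scaleDr ser_scaleDl.
HB.instance Definition _ := Lmodule_isPzAlg.Build K (series B)
  ser_scaleAl ser_scaleAr.

Lemma serDE f g n : (f + g) n = f n + g n. Proof. by []. Qed.
Lemma serNE f n : (- f) n = - f n. Proof. by []. Qed.
Lemma serBE f g n : (f - g) n = f n - g n. Proof. by []. Qed.
Lemma ser0E n : (0 : series B) n = 0. Proof. by []. Qed.
Lemma ser1E n : (1 : series B) n = (n == 0%N)%:R. Proof. by []. Qed.
Lemma serZE k f n : (k *: f) n = k *: f n. Proof. by []. Qed.
Lemma serME f g n : (f * g) n = \sum_(i < n.+1) f i * g (n - i)%N.
Proof. by []. Qed.

End Series.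

Section AssociatedGraded.
Variables (K : pzRingType) (B : pzAlgType K) (F : filtration B).

Lemma fil_leq m n : (m <= n)%N -> {subset F m <= F n}.
Proof.
move=> /subnK <-; elim: (n - m)%N => // k IH x /IH; exact: filS.
Qed.

Definition fil_pred (n : nat) : {pred B} :=
  if n is m.+1 then F m else pred1 0.

Lemma fil_predP n x : x \in fil_pred n -> x \in F n.
Proof. by case: n => [/eqP-> | n]; [exact: rpred0 | exact: filS]. Qed.

Lemma fil_pred0 n : 0 \in fil_pred n.
Proof. by case: n => [|n]; [exact: eqxx | exact: rpred0]. Qed.

Lemma fil_predD n x y :
  x \in fil_pred n -> y \in fil_pred n -> x + y \in fil_pred n.
Proof.
case: n => [/eqP-> /eqP->|n]; first by rewrite addr0 fil_pred0.
exact: rpredD.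
Qed.

Lemma fil_predMl m n x y :
  x \in F m -> y \in fil_pred n -> x * y \in fil_pred (m + n).
Proof.
case: n => [_ /eqP->|n xm yn]; first by rewrite mulr0 fil_pred0.
by rewrite addnS; apply: filM.
Qed.

Lemma fil_predMr m n x y :
  x \in fil_pred m -> y \in F n -> x * y \in fil_pred (m + n).
Proof.
case: m => [/eqP-> _|m xm yn]; first by rewrite mul0r fil_pred0.
exact: filM.
Qed.

(* The Rees algebra (+)_n F^n t^n. *)
Definition rees_pred : {pred series B} := fun f =>
  `[< (forall n, f n \in F n) /\
      exists N, forall n, (N <= n)%N -> f n = 0 >].

Lemma rees_predE f : (f \in rees_pred) =
  `[< (forall n, f n \in F n) /\
      exists N, forall n, (N <= n)%N -> f n = 0 >].
Proof. by []. Qed.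

Lemma rees_subring : subring_closed rees_pred.
Proof.
split.
- rewrite rees_predE; apply/asboolP; split=> [n|].
    by rewrite ser1E; case: n => [|n]; [exact: fil_one | exact: rpred0].
  by exists 1%N => -[].
- move=> f g; rewrite !rees_predE => /asboolP[fF [N fN]] /asboolP[gF [M gM]].
  apply/asboolP; split=> [n|]; first by rewrite serBE rpredB.
  exists (maxn N M) => n; rewrite geq_max => /andP[hN hM].
  by rewrite serBE fN // gM // subr0.
- move=> f g; rewrite !rees_predE => /asboolP[fF [N fN]] /asboolP[gF [M gM]].
  apply/asboolP; split=> [n|].
    rewrite serME rpred_sum // => i _.
    by have := filM (fF i) (gF (n - i)%N); rewrite subnKC // leq_ord.
  exists (N + M)%N => n hn; rewrite serME big1 // => i _.
  case: (leqP N i) => [/fN ->|iN]; first by rewrite mul0r.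
  by rewrite gM ?mulr0 // leq_subRL ?leq_ord // (leq_trans _ hn) // leq_add2r ltnW.
Qed.

Lemma rees_submod : subsemimod_closed rees_pred.
Proof.
split; first split.
- rewrite rees_predE; apply/asboolP; split=> [n|]; last by exists 0%N.
  exact: rpred0.
- move=> f g; rewrite !rees_predE => /asboolP[fF [N fN]] /asboolP[gF [M gM]].
  apply/asboolP; split=> [n|]; first by rewrite serDE rpredD.
  exists (maxn N M) => n; rewrite geq_max => /andP[hN hM].
  by rewrite serDE fN // gM // addr0.
- move=> k f; rewrite !rees_predE => /asboolP[fF [N fN]].
  apply/asboolP; split=> [n|]; first by rewrite serZE rpredZ.
  by exists N => n hn; rewrite serZE fN // scaler0.
Qed.

HB.instance Definition _ :=
  GRing.isSubringClosed.Build (series B) rees_pred rees_subring.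
HB.instance Definition _ :=
  GRing.isSubmodClosed.Build K (series B) rees_pred rees_submod.

Record rees := Rees { rees_val :> series B; _ : rees_val \in rees_pred }.

HB.instance Definition _ := [isSub for rees_val].
HB.instance Definition _ := [Choice of rees by <:].
HB.instance Definition _ := [SubChoice_isSubZmodule of rees by <:].
HB.instance Definition _ := 
  GRing.SubZmodule_isSubPzRing.Build (series B) rees_pred rees rees_subring.
HB.instance Definition _ := [SubZmodule_isSubLmodule of rees by <:].

Lemma rees_scalerAl (k : K) (x y : rees) : k *: (x * y) = (k *: x) * y.
Proof. by apply: val_inj; apply: ser_scaleAl. Qed.

Lemma rees_scalerAr (k : K) (x y : rees) : k *: (x * y) = x * (k *: y).
Proof. by apply: val_inj; apply: ser_scaleAr. Qed.

HB.instance Definition _ := Lmodule_isPzAlg.Build K rees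
  rees_scalerAl rees_scalerAr.

(* The ideal (+)_n F^(n-1) t^n, where F^(-1) = 0. *)
Definition rees_low (x : rees) : Prop := forall n, val x n \in fil_pred n.

Lemma reesF (x : rees) n : val x n \in F n.
Proof. by case: x => f /= /asboolP[]. Qed.

Lemma rees_lowP : two_sided_ideal rees_low.
Proof.
split=> [n|x y hx hy n|a x b hx n]; first exact: fil_pred0.
  by apply: fil_predD.
have sumP m (G : 'I_m.+1 -> B) p :
    (forall i, G i \in fil_pred p) -> \sum_i G i \in fil_pred p.
  by move=> hG; elim/big_ind: _ => // *; [apply: fil_pred0 | apply: fil_predD].
rewrite -[val (a * x * b) n]/((val a * val x * val b : series B) n) serME.
apply: (sumP) => i; rewrite -[X in fil_pred X](@subnKC i n) ?leq_ord //.
apply: fil_predMr (reesF _ _); rewrite serME; apply: sumP => j.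
rewrite -[X in fil_pred X](@subnKC j i) ?leq_ord //.
exact: fil_predMl (reesF _ _) (hx _).
Qed.

(* gr(B) = (+)_n F^n/F^(n-1) with the induced product, as the quotient of
   (+)_n F^n t^n by (+)_n F^(n-1) t^n. *)
Definition gr : Type := quot_alg (Ideal rees_lowP).

HB.instance Definition _ := PzAlg.on gr.

Lemma ser_mono_rees n x : x \in F n ->
  ((fun k => if k == n then x else 0) : series B) \in rees_pred.
Proof.
move=> xF; rewrite rees_predE; apply/asboolP; split=> [k|].
  by case: eqP => [->|_] //; apply: rpred0.
by exists n.+1 => k; case: eqP => // ->; rewrite ltnn.
Qed.

(* The class of x, an element of F^n, in F^n/F^(n-1). *)
Definition gr_class n (x : B) (xF : x \in F n) : gr :=
  quot_pi (Ideal rees_lowP) (Rees (ser_mono_rees xF)).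

End AssociatedGraded.

Section QuotientFiltration.
Variables (K : pzRingType) (A : pzAlgType K) (F : filtration A) (I : ideal A).

Definition quot_fil (n : nat) : {pred quot_alg I} :=
  fun y => `[< exists2 x, x \in F n & y = quot_pi I x >].

Lemma quot_filP n y :
  reflect (exists2 x, x \in F n & y = quot_pi I x) (y \in quot_fil n).
Proof. exact: asboolP. Qed.

Lemma quot_fil_submod n : submod_closed (quot_fil n).
Proof.
split=> [|k x y /quot_filP[x' xF ->] /quot_filP[y' yF ->]]; apply/quot_filP.
  by exists 0; rewrite ?rpred0 ?raddf0.
by exists (k *: x' + y'); rewrite ?rpredD ?rpredZ // linearP.
Qed.

Lemma quot_filS n : {subset quot_fil n <= quot_fil n.+1}.
Proof. by move=> x /quot_filP[y /filS yF ->]; apply/quot_filP; exists y. Qed.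

Lemma quot_fil_one : 1 \in quot_fil 0.
Proof. by apply/quot_filP; exists 1; [apply: fil_one | rewrite rmorph1]. Qed.

Lemma quot_filM m n x y :
  x \in quot_fil m -> y \in quot_fil n -> x * y \in quot_fil (m + n).
Proof.
move=> /quot_filP[x' xF ->] /quot_filP[y' yF ->]; apply/quot_filP.
by exists (x' * y'); [apply: filM | rewrite rmorphM].
Qed.

Definition quot_filtration : filtration (quot_alg I) :=
  Filtration quot_fil_submod quot_filS quot_fil_one quot_filM.

End QuotientFiltration.

(* T(E) for E with basis nabla_0, ..., nabla_s, as the K-algebra of the free
   monoid on {0, ..., s}: the words of length n are a basis of E^(x)n and the
   tensor product is the multiplication. *)
Definition tensor_alg (K : fieldType) (s : nat) : Type :=
  {malg K[{fmonom 'I_s.+1}]}.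

Section TensorAlgebra.
Variables (K : fieldType) (s : nat).

Local Notation T := (tensor_alg K s).

HB.instance Definition _ := GRing.Lalgebra.on T.

Lemma tensor_scalerAl (k : K) (x y : T) : k *: (x * y) = (k *: x) * y.
Proof. exact: scalerAl. Qed.

Lemma tensor_scalerAr (k : K) (x y : T) : k *: (x * y) = x * (k *: y).
Proof.
apply/malgP=> w; rewrite mcoeffZ.
rewrite (mcoeffMlw (d1 := msupp x) (d2 := msupp y)) ?fsubset_refl //.
rewrite (mcoeffMlw (d1 := msupp x) (d2 := msupp y)) ?msuppZ_le //.
rewrite mulr_sumr; apply: eq_bigr => k1 _.
rewrite mulr_sumr; apply: eq_bigr => k2 _.
by rewrite mulrnAr mcoeffZ mulrCA.
Qed.

HB.instance Definition _ := Lmodule_isPzAlg.Build K T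
  tensor_scalerAl tensor_scalerAr.

Definition nabla (l : 'I_s.+1) : T := << fmu l >>.

(* F^n = (+)_(i <= n) E^(x)i *)
Definition tensor_fil (n : nat) : {pred T} :=
  fun x => all (fun w => fdeg w <= n)%N (msupp x).

Lemma tensor_filP n (x : T) :
  reflect (forall w, x@_w != 0 -> (fdeg w <= n)%N) (x \in tensor_fil n).
Proof.
apply: (iffP allP) => h w; first by rewrite mcoeff_neq0; apply: h.
by move=> hw; apply: h; rewrite mcoeff_neq0.
Qed.

Lemma tensor_fil_submod n : submod_closed (tensor_fil n).
Proof.
split=> [|k x y /tensor_filP hx /tensor_filP hy]; apply/tensor_filP => w.
  by rewrite mcoeff0 eqxx.
rewrite mcoeffD mcoeffZ; case: (eqVneq (y@_w) 0) => [->|/hy //].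
by rewrite addr0 mulf_eq0 negb_or => /andP[_ /hx].
Qed.

Lemma tensor_filS n : {subset tensor_fil n <= tensor_fil n.+1}.
Proof. by move=> x /tensor_filP h; apply/tensor_filP => w /h /leqW. Qed.

Lemma tensor_fil_one : 1 \in tensor_fil 0.
Proof.
apply/tensor_filP => w; rewrite mcoeff1.
by case: (w =P mone) => [->|_]; rewrite ?fdeg1 ?eqxx.
Qed.

Lemma tensor_filM m n x y :
  x \in tensor_fil m -> y \in tensor_fil n -> x * y \in tensor_fil (m + n).
Proof.
move=> /allP hx /allP hy; apply/allP => w /msuppM_le[u [v [ux vy ->]]].
by rewrite fdegM leq_add ?hx ?hy.
Qed.

Definition tensor_filtration : filtration T :=
  Filtration tensor_fil_submod tensor_filS tensor_fil_one tensor_filM.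

Lemma nabla_fil l : nabla l \in tensor_filtration 1%N.
Proof.
apply/tensor_filP => w; rewrite mcoeffU1.
by case: (fmu l =P w) => [<-|_]; rewrite ?fdegU ?eqxx.
Qed.

End TensorAlgebra.

Section YangMills.
Variables (K : fieldType) (s : nat) (g : 'M[K]_s.+1).

Local Notation T := (tensor_alg K s).
Local Notation h := (invmx g).
Local Notation "'F^2'" := (fil_piece (tensor_filtration K s) 2).

(* g with lower indices is the matrix g; with upper indices it is [h]. *)
Definition YM_W (r : 'I_s.+1) : T :=
  \sum_l \sum_m \sum_n
    (h r l * h m n + h r n * h l m - 2%:R * h r m * h l n) *:
      (nabla K l * nabla K m * nabla K n).

Definition YM_R_pred : {pred T} :=
  fun x => `[< exists c : 'I_s.+1 -> K, x = \sum_r c r *: YM_W r >].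

Lemma YM_R_submod : submod_closed YM_R_pred.
Proof.
split=> [|k x y /asboolP[c ->] /asboolP[d ->]]; apply/asboolP.
  by exists (fun=> 0); rewrite big1 // => r _; rewrite scale0r.
exists (fun r => k * c r + d r); rewrite scaler_sumr -big_split /=.
by apply: eq_bigr => r _; rewrite scalerDl scalerA.
Qed.

HB.instance Definition _ :=
  GRing.isSubmodClosed.Build K T YM_R_pred YM_R_submod.

Record YM_R := YMRel { YM_R_val :> T; _ : YM_R_val \in YM_R_pred }.

HB.instance Definition _ := [isSub for YM_R_val].
HB.instance Definition _ := [Choice of YM_R by <:].
HB.instance Definition _ := [SubChoice_isSubLmodule of YM_R by <:].

Lemma YM_W_in r : YM_W r \in YM_R_pred.
Proof.
apply/asboolP; exists (fun i => (i == r)%:R).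
rewrite (bigD1 r) //= eqxx scale1r big1 ?addr0 // => i /negbTE->.
by rewrite scale0r.
Qed.

Definition YM_rel (r : 'I_s.+1) : YM_R := YMRel (YM_W_in r).

Definition YM_alg : Type :=
  quot_alg (gen_ideal (fun x : T => x \in YM_R_pred)).

HB.instance Definition _ := PzAlg.on YM_alg.

Variable phi : {linear YM_R -> F^2}.

Definition YM_phi_ideal : ideal T :=
  gen_ideal (fun y => exists x : YM_R, y = val x - val (phi x)).

Definition YM_phi_alg : Type := quot_alg YM_phi_ideal.

HB.instance Definition _ := PzAlg.on YM_phi_alg.

Definition YM_phi_fil : filtration YM_phi_alg :=
  quot_filtration (tensor_filtration K s) YM_phi_ideal.

Lemma nabla_phi_fil l :
  quot_pi YM_phi_ideal (nabla K l) \in YM_phi_fil 1%N.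
Proof. by apply/asboolP; exists (nabla K l); first exact: nabla_fil. Qed.

(* The nabla_l generate A, so f can only be the canonical homomorphism
   A -> gr(A_phi), and it preserves degrees. *)
Definition YM_PBW : Prop :=
  exists f : {rmorphism YM_alg -> gr YM_phi_fil},
    [/\ scalable f,
        forall l, f (quot_pi _ (nabla K l)) = gr_class (nabla_phi_fil l)
      & bijective f].

End YangMills.

(* The elements of wedge^3 K^(s+1) when 2 is invertible in K. *)
Definition antisymmetric3 (K : fieldType) (s : nat)
    (w : 'I_s.+1 -> 'I_s.+1 -> 'I_s.+1 -> K) : Prop :=
  forall a b c,
    [/\ w b a c = - w a b c, w a c b = - w a b c & w c b a = - w a b c].

Definition symmetric3 (K : fieldType) (s : nat)
    (t : 'I_s.+1 -> 'I_s.+1 -> 'I_s.+1 -> K) : Prop :=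
  forall a b c, [/\ t b a c = t a b c, t a c b = t a b c & t c b a = t a b c].

(* Main.v *)
From HB Require Import structures.
Require Import Defs.
From mathcomp Require Import all_boot all_algebra.
From mathcomp Require Import finmap boolp monalg ring zify.

(* PBW means that the leading part of every element of the ideal of A_phi lies
   in (R). The identity sum_r [W^r, nabla_r] = 0 makes
   sum_r [phi(W^r), nabla_r] an element of that ideal of degree at most 3, so
   PBW forces it to be sum_r b_r (W^r - phi(W^r)) for some b; reading off
   coefficients and splitting a cyclically invariant tensor into its symmetric
   and antisymmetric parts gives the stated form of phi.
   Conversely, after diagonalising g the relations have, for the
   degree-lexicographic order in which nabla_0 is the largest letter, the
   leading words 00r (r > 0) and 011. Their only overlap is 0011, and it is
   resolved exactly by the identity
   sum_r [phi(W^r), nabla_r] = sum_r b_r (W^r - phi(W^r)). *)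

Set Implicit Arguments.
Unset Strict Implicit.
Unset Printing Implicit Defensive.

Import GRing.Theory.
Local Open Scope ring_scope.

(** * Free algebras *)

(** The sum of commutators decides everything because, for a diagonal form, [r_1 x_1] and [x_0 r_0]
    are its only products with leading word 0011, and both have leading coefficient [e_0 e_1] there.
    Up to this factor and smaller terms it is therefore the S-element of the single overlap. The
    relations are handled as an abstract family [r_i] with cubic part [W^i] and with [sum_i
    [r_i, x_i] = sum_i c_i r_i]. These two conditions are covariant under linear changes of the
    generators, so the diagonalisation of the form never has to touch the coefficients j. The
    diamond lemma uses neither rewriting nor normal forms. It bounds the leading words in a
    representation of an element of the ideal and lowers this bound until it matches the degree of
    the element. Inverting 2 serves to diagonalise the form and to split cyclic tensors. On a cyclic
    tensor all transpositions act alike, so a half, not a sixth, suffices in the symmetrisation, and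
    characteristic 3 is covered. *)

(* The free algebra is used through this interface: with the concrete
   [tensor_alg], unification unfolds its whole tower of instances. *)
Record free_alg (K : fieldType) (s : nat) := FreeAlg {
  free_sort :> pzAlgType K;
  word : seq 'I_s.+1 -> free_sort;
  coef : seq 'I_s.+1 -> free_sort -> K;
  word_nil : word [::] = 1;
  wordM : forall u v, word u * word v = word (u ++ v);
  fcoefD : forall u x y, coef u (x + y) = coef u x + coef u y;
  fcoefZ : forall u k x, coef u (k *: x) = k * coef u x;
  coef_word : forall u v, coef u (word v) = (v == u)%:R;
  coef_inj : forall x y, (forall u, coef u x = coef u y) -> x = y;
  free_ext : forall (V : lmodType K) (h : seq 'I_s.+1 -> V),
    {f : {linear free_sort -> V} | forall u, f (word u) = h u};
  free_ind : forall P : free_sort -> Prop,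
    P 0 -> (forall k u x, P x -> P (k *: word u + x)) -> forall x, P x
}.

Arguments coef {K s} f u x.
Arguments word {K s} f u.
Arguments free_ext {K s} f {V} h.
Arguments free_ind {K s} f P.

Section TensorFree.
Variables (K : fieldType) (s : nat).
Local Notation T := (tensor_alg K s).
Local Notation I := 'I_s.+1.

(* Spelled so that [tensor_word [:: l]] is convertible to [nabla K l]. *)
Definition tensor_word (u : seq I) : T := << fmonom_of_seq fmonom_key u >>.
Definition tensor_coef (u : seq I) (x : T) : K := x@_(FMonom u).

Lemma tensor_word_nil : tensor_word [::] = 1.
Proof. by []. Qed.

Lemma tensor_wordM u v : tensor_word u * tensor_word v = tensor_word (u ++ v).
Proof.
rewrite /tensor_word malgM_def fgmulUU mulr1; congr << _ >>.
by apply: etrans (fmmulE _ _) _; rewrite !fmE.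
Qed.

Lemma tensor_coefD u (x y : T) : tensor_coef u (x + y) = tensor_coef u x + tensor_coef u y.
Proof. exact: mcoeffD. Qed.

Lemma tensor_coefZ u k (x : T) : tensor_coef u (k *: x) = k * tensor_coef u x.
Proof. exact: mcoeffZ. Qed.

Lemma tensor_coef_word u v : tensor_coef u (tensor_word v) = (v == u)%:R.
Proof. by rewrite /tensor_coef /tensor_word fmE mcoeffU1 fmP. Qed.

Lemma tensor_coef_inj (x y : T) : (forall u, tensor_coef u x = tensor_coef u y) -> x = y.
Proof. by move=> e; apply/malgP => -[u]; apply: e. Qed.

Lemma tensor_ind (P : T -> Prop) :
  P 0 -> (forall k u x, P x -> P (k *: tensor_word u + x)) -> forall x, P x.
Proof.
move=> P0 PD x.
have -> : x = \sum_(m <- msupp x) tensor_coef m x *: tensor_word m.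
  rewrite [LHS]monalgE; apply: eq_bigr => m _; apply/malgP => -[u].
  have := tensor_coefZ u (tensor_coef m x) (tensor_word m).
  by rewrite /tensor_coef => ->; rewrite /tensor_word fmE !mcoeffU fmP mulrnAr mulr1 fmK.
by elim: (enum_fset _) => [|m r IH]; rewrite ?big_nil // big_cons; apply: PD.
Qed.

Section LinearExtension.
Variables (V : lmodType K) (h : seq I -> V).

Definition tensor_linext (x : T) : V := \sum_(m <- msupp x) x@_m *: h m.

Lemma tensor_extE (d : {fset {fmonom I}}) (x : T) : (msupp x `<=` d)%fset ->
  tensor_linext x = \sum_(m <- d) x@_m *: h m.
Proof.
move=> le; rewrite /tensor_linext (big_fset_incl _ le) // => m _.
by move=> /mcoeff_outdom e; rewrite e scale0r.
Qed.

Lemma tensor_ext_zmod : zmod_morphism tensor_linext.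
Proof.
move=> x y; pose d := (msupp x `|` msupp y)%fset.
rewrite (@tensor_extE d x) ?fsubsetUl // (@tensor_extE d y) ?fsubsetUr //.
rewrite (@tensor_extE d) ?msuppB_le // -sumrB.
by apply: eq_bigr => m _; rewrite mcoeffB scalerBl.
Qed.

Lemma tensor_ext_scale : scalable tensor_linext.
Proof.
move=> k x; rewrite (tensor_extE (msuppZ_le k x)) scaler_sumr.
by apply: eq_bigr => m _; rewrite mcoeffZ scalerA.
Qed.

HB.instance Definition _ := GRing.isZmodMorphism.Build T V tensor_linext tensor_ext_zmod.
HB.instance Definition _ :=
  GRing.isScalable.Build K (T : pzAlgType K) V *:%R tensor_linext tensor_ext_scale.

Lemma tensor_ext :
  {f : {linear (T : pzAlgType K) -> V} | forall u, f (tensor_word u) = h u}.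
Proof.
exists tensor_linext => u /=.
by rewrite /tensor_linext /tensor_word fmE msuppU1 big_seq_fset1 mcoeffUU scale1r.
Qed.

End LinearExtension.

Definition tensor_free : free_alg K s :=
  @FreeAlg K s T tensor_word tensor_coef tensor_word_nil tensor_wordM tensor_coefD
    tensor_coefZ tensor_coef_word tensor_coef_inj tensor_ext tensor_ind.

(** Links the concrete filtration to the condition [deg_le] on coefficients, in the form that the
    hypothesis [FP] of the PBW section asks for. *)
Lemma tensor_fil_coef n (x : T) :
  reflect (forall u, coef tensor_free u x != 0 -> (size u <= n)%N)
    (x \in tensor_filtration K s n).
Proof.
apply: (iffP (tensor_filP n x)) => [h u|h [u]]; [exact: (h (FMonom u)) | exact: h].
Qed.

End TensorFree.

Section HomogeneousComponents.
Variables (K : fieldType) (s : nat) (T : free_alg K s).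
Local Notation I := 'I_s.+1.
Local Notation word := (word T).
Local Notation coef := (coef T).
Implicit Types (x y : T) (u v : seq I).

Lemma coef_zmod u : zmod_morphism (coef u).
Proof. by move=> x y; rewrite -scaleN1r fcoefD fcoefZ mulN1r. Qed.

HB.instance Definition _ u :=
  GRing.isZmodMorphism.Build T K (coef u) (coef_zmod u).

Definition hcomp (n : nat) : {linear T -> T} :=
  sval (free_ext T (fun u => (size u == n)%:R *: word u)).

Lemma hcomp_word n u : hcomp n (word u) = (size u == n)%:R *: word u.
Proof. by rewrite /hcomp; case: free_ext => f /= ->. Qed.

Lemma coef_hcomp n x u :
  coef u (hcomp n x) = if size u == n then coef u x else 0.
Proof.
elim/(free_ind T): x => [|k v x IH]; first by rewrite linear0 raddf0 if_same.
rewrite linearP 2!fcoefD IH !fcoefZ hcomp_word fcoefZ coef_word.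
case: (eqVneq v u) => [->|_]; last by rewrite !mulr0; case: ifP; rewrite ?addr0 ?add0r.
by case: eqP; rewrite ?mul1r // mul0r mulr0 addr0.
Qed.

(** The grading in the form of a Cauchy product, which is how [series] multiplies; [symbolM] rests
    on it. *)
Lemma hcompM n x y :
  hcomp n (x * y) = \sum_(i < n.+1) hcomp i x * hcomp (n - i) y.
Proof.
elim/(free_ind T): x => [|k u x IH].
  by rewrite mul0r linear0 big1 // => i _; rewrite linear0 mul0r.
rewrite mulrDl linearD IH.
under [RHS]eq_bigr do rewrite linearD mulrDl.
rewrite big_split /=; congr (_ + _) => {x IH}.
elim/(free_ind T): y => [|k' v y IH].
  by rewrite mulr0 linear0 big1 // => i _; rewrite linear0 mulr0.
rewrite mulrDr linearD IH.
under [RHS]eq_bigr do rewrite linearD mulrDr.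
rewrite big_split /=; congr (_ + _) => {y IH}.
rewrite -pzscalerAl -pzscalerAr wordM !linearZ /= hcomp_word size_cat.
rewrite scalerA.
(* Only the index i = size u can contribute, and it does so exactly when the two lengths add up to
   n. *)
transitivity ((k * k') *:
    \sum_(i < n.+1) ((size u == i) * (size v == n - i))%N%:R *: word (u ++ v)).
  rewrite -scaler_suml -natr_sum; congr (_ *: (_%:R *: _)).
  have [e|ne] := eqVneq (size u + size v)%N n.
    have lt : (size u < n.+1)%N by rewrite -e ltnS leq_addr.
    have e' : (n - size u = size v)%N by rewrite -e addKn.
    rewrite (bigD1 (Ordinal lt)) //= eqxx e' eqxx big1 ?addn0 // => i.
    by rewrite -val_eqE /= eq_sym => /negbTE ->; rewrite mul0n.
  rewrite big1 // => i _; case: eqP => //= e; case: eqP => //= e'.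
  by rewrite e e' subnKC ?eqxx // leq_ord in ne.
rewrite scaler_sumr; apply: eq_bigr => i _.
rewrite !linearZ /= !hcomp_word natrM -wordM.
rewrite -!pzscalerAr -!pzscalerAl !scalerA.
by congr (_ *: _); ring.
Qed.

End HomogeneousComponents.

Section Support.
Variables (K : fieldType) (s : nat) (T : free_alg K s).
Local Notation I := 'I_s.+1.
Local Notation word := (word T).
Local Notation coef := (coef T).
Implicit Types (x y : T) (u v : seq I).

Lemma free_supp x : exists l, uniq l /\ forall u, coef u x != 0 -> u \in l.
Proof.
elim/(free_ind T): x => [|k u x [l [ul hl]]].
  by exists [::]; split=> // u; rewrite raddf0 eqxx.
exists (undup (u :: l)); split=> [|v]; first exact: undup_uniq.
rewrite mem_undup inE fcoefD fcoefZ coef_word [v == u]eq_sym.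
by case: (eqVneq u v) => //= _; rewrite mulr0 add0r; apply: hl.
Qed.

(** Unlike in [free_ind], every word added has a nonzero coefficient in x, so a bound on the rank of
    the words of x stays available; the reduction of tails needs this. *)
Lemma supp_ind (P : T -> Prop) x : P 0 ->
  (forall k u y, coef u x != 0 -> P y -> P (k *: word u + y)) -> P x.
Proof.
move=> P0 PD; have [l [ul hl]] := free_supp x.
have -> : x = \sum_(u <- l | coef u x != 0) coef u x *: word u.
  apply: coef_inj => v; rewrite raddf_sum /=.
  under eq_bigr do rewrite fcoefZ coef_word.
  have [e|ne] := eqVneq (coef v x) 0.
    rewrite e big1 // => u ne; case: eqVneq => [uv|]; last by rewrite mulr0.
    by rewrite uv e eqxx in ne.
  rewrite big_mkcond (bigD1_seq v) ?hl //= ne eqxx mulr1 big1 ?addr0 // => u.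
  by move=> /negbTE->; rewrite mulr0 if_same.
elim: l {ul hl} => [|u l IH]; rewrite ?big_nil // big_cons.
by case: ifP => // h; apply: PD.
Qed.

Lemma cat_inj a b : injective (fun u : seq I => a ++ u ++ b).
Proof.
move=> u v e; have := congr1 size e; rewrite !size_cat => /addnI/addIn es.
move/eqP: e; rewrite eqseq_cat // eqxx eqseq_cat //.
by rewrite eqxx andbT => /eqP.
Qed.

Lemma coef_words a b v x : coef (a ++ v ++ b) (word a * x * word b) = coef v x.
Proof.
elim/(free_ind T): x => [|k u x IH]; first by rewrite mulr0 mul0r !raddf0.
rewrite mulrDr mulrDl !fcoefD IH -pzscalerAr -pzscalerAl !fcoefZ !wordM.
by rewrite !coef_word -catA (inj_eq (@cat_inj a b)).
Qed.

Lemma coef_words_neq0 a b u x : coef u (word a * x * word b) != 0 ->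
  exists2 v, u = a ++ v ++ b & coef v x != 0.
Proof.
move=> h; suff [v e] : exists v, u = a ++ v ++ b.
  by exists v; rewrite // -(coef_words a b) -e.
elim/(free_ind T): x h => [|k v x IH]; first by rewrite mulr0 mul0r raddf0 eqxx.
rewrite mulrDr mulrDl fcoefD -pzscalerAr -pzscalerAl fcoefZ !wordM coef_word.
case: (eqVneq ((a ++ v) ++ b) u) => [<- _|_]; first by exists v; rewrite catA.
by rewrite mulr0 add0r.
Qed.

Lemma hcomp_words a b k x :
  hcomp T (size a + k + size b) (word a * x * word b)
  = word a * hcomp T k x * word b.
Proof.
elim/(free_ind T): x => [|c u x IH]; first by rewrite !(linear0, mulr0, mul0r).
rewrite mulrDr mulrDl !linearD mulrDr mulrDl IH; congr (_ + _).
rewrite -pzscalerAr -pzscalerAl !linearZ /= !wordM !hcomp_word !size_cat.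
by rewrite -!(pzscalerAr, pzscalerAl) !wordM eqn_add2r eqn_add2l.
Qed.

Definition deg_le n x := forall u, coef u x != 0 -> (size u <= n)%N.

Lemma hcomp_deg_le n m x : deg_le n x -> (n < m)%N -> hcomp T m x = 0.
Proof.
move=> h nm; apply: coef_inj => u; rewrite coef_hcomp raddf0.
case: eqP => // e; apply/eqP/negPn/negP => /h.
by rewrite e leqNgt nm.
Qed.

Lemma deg_le_words a b n x :
  deg_le n x -> deg_le (size a + n + size b) (word a * x * word b).
Proof.
move=> h u /coef_words_neq0[v -> /h]; rewrite !size_cat; lia.
Qed.

(** * A monomial order on words, encoded in the natural numbers *)

Section Rank.
Local Open Scope nat_scope.

(* A number in base s + 2 without the digit 0: the order of the ranks is
   the degree-lexicographic one, the letter 0 being the largest. *)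
Definition rank u := foldl (fun n (i : I) => n * s.+2 + (s.+1 - i)) 0 u.

Lemma rank_cat u v : rank (u ++ v) = rank u * s.+2 ^ size v + rank v.
Proof.
elim/last_ind: v => [|v i IH]; first by rewrite cats0 expn0 muln1 addn0.
rewrite -rcons_cat /rank !foldl_rcons -!/(rank _) IH size_rcons expnS.
by rewrite mulnDl -mulnA [_ ^ _ * _]mulnC addnA.
Qed.

Lemma rank1 i : rank [:: i] = s.+1 - i.
Proof. by []. Qed.

Lemma rank_lt u : rank u < s.+2 ^ size u.
Proof.
elim: u => //= i u IH; rewrite -cat1s rank_cat rank1 expnS.
have : (s.+1 - i).+1 * s.+2 ^ size u <= s.+2 * s.+2 ^ size u.
  by rewrite leq_mul2r ltnS leq_subr orbT.
by apply: leq_trans; rewrite mulSnr -addnS leq_add2l.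
Qed.

Lemma rank_ge i u : s.+2 ^ size u <= rank (i :: u).
Proof.
rewrite -cat1s rank_cat rank1 (leq_trans _ (leq_addr _ _)) //.
by rewrite leq_pmull // subn_gt0.
Qed.

(** No digit is 0, so a word of length n + 1 has rank at least (s + 2)^n, which exceeds the rank of
    every word of length at most n. *)
Lemma rank_size u v : size u < size v -> rank u < rank v.
Proof.
case: v => // i v; rewrite ltnS => uv.
rewrite (leq_trans (rank_lt u)) // (leq_trans _ (rank_ge i v)) //.
by rewrite leq_pexp2l.
Qed.

(** The digits lie between 1 and s + 1, so division by the base s + 2 recovers them. Two terms whose
    leading words have equal rank thus have the same leading word. *)
Lemma rank_inj : injective rank.
Proof.
elim/last_ind => [|u i IH] v; case/lastP: v => [//|v j] //.
- by have := @rank_size [::] (rcons v j); rewrite size_rcons => /(_ isT); lia.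
- by have := @rank_size [::] (rcons u i); rewrite size_rcons => /(_ isT); lia.
rewrite -!cats1 !rank_cat !rank1 /= expn1 => e.
have lt (k : I) : s.+1 - k < s.+2 by rewrite ltnS leq_subr.
have eu : rank u = rank v.
  have := congr1 (divn^~ s.+2) e.
  by rewrite !divnMDl // !divn_small // !addn0.
have /= := ltn_ord i; have /= := ltn_ord j => lj li.
rewrite (IH _ eu); congr (_ ++ [:: _]); apply: val_inj => /=; lia.
Qed.

(** This compatibility makes the order a monomial order: the leading word of [a r_i b] is
    [a ++ lead i ++ b]. *)
Lemma rank_mono a b u v :
  rank u < rank v -> rank (a ++ u ++ b) < rank (a ++ v ++ b).
Proof.
move=> uv; case: (ltngtP (size u) (size v)) => [l|g|e].
- by apply: rank_size; rewrite !size_cat ltn_add2l ltn_add2r.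
- by have := rank_size g; lia.
rewrite !rank_cat !size_cat e ltn_add2l ltn_add2r ltn_mul2r uv andbT.
by rewrite expn_gt0.
Qed.

End Rank.
End Support.

(** * The diamond lemma *)

Lemma gen_ideal_sub (A : pzRingType) (X Y : A -> Prop) x :
  (forall y, X y -> gen_ideal Y y) -> gen_ideal X x -> gen_ideal Y x.
Proof. by move=> h hx; apply: (hx (gen_ideal Y)) => //; apply: idealP. Qed.

Lemma gen_ideal_gen (A : pzRingType) (X : A -> Prop) x : X x -> gen_ideal X x.
Proof. by move=> hx I _; apply. Qed.

Lemma gen_idealZ (K : pzRingType) (A : pzAlgType K) (I : ideal A) k (x : A) :
  I x -> I (k *: x).
Proof.
have [_ _ IM] := idealP I; move=> /(IM (k *: (1 : A)) _ 1).
by rewrite mulr1 -pzscalerAl mul1r.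
Qed.

Lemma ideal_sum (A : pzRingType) (I : ideal A) (J : Type) (l : seq J)
    (P : pred J) (F : J -> A) :
  (forall j, P j -> I (F j)) -> I (\sum_(j <- l | P j) F j).
Proof. by move=> h; have [I0 ID _] := idealP I; elim/big_ind: _. Qed.

Section Groebner.
Variables (K : fieldType) (s : nat) (T : free_alg K s).
Local Notation I := 'I_s.+1.
Local Notation word := (word T).
Local Notation coef := (coef T).
Implicit Types (x y : T) (u v : seq I).

Variables (S : Type) (lead : S -> seq I) (r : S -> T) (d : nat).
Hypothesis size_lead : forall i, size (lead i) = d.
Hypothesis r_monic : forall i, coef (lead i) (r i) = 1.
Hypothesis r_lower : forall i u,
  coef u (r i) != 0 -> u != lead i -> (rank u < rank (lead i))%N.

(** The elements of the ideal having a representation in which every single term, not only the sum,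
    has a leading word of rank below m. *)
Inductive red_span (m : nat) : T -> Prop :=
| red_span_zero : red_span m 0
| red_span_add1 k a i b x : (rank (a ++ lead i ++ b) < m)%N -> red_span m x ->
    red_span m (k *: (word a * r i * word b) + x).

Lemma red_spanD m x y : red_span m x -> red_span m y -> red_span m (x + y).
Proof.
elim=> [|k a i b z lt _ IH] hy; first by rewrite add0r.
by rewrite -addrA; apply: red_span_add1 => //; apply: IH.
Qed.

Lemma red_spanZ m k x : red_span m x -> red_span m (k *: x).
Proof.
elim=> [|c a i b z lt _ IH]; first by rewrite scaler0; apply: red_span_zero.
by rewrite scalerDr scalerA; apply: red_span_add1.
Qed.

Lemma red_spanB m x y : red_span m x -> red_span m y -> red_span m (x - y).
Proof. by move=> hx hy; rewrite -scaleN1r; apply/red_spanD/red_spanZ. Qed.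

Lemma red_span_sum m (J : Type) (l : seq J) (P : pred J) (F : J -> T) :
  (forall j, P j -> red_span m (F j)) -> red_span m (\sum_(j <- l | P j) F j).
Proof.
by move=> h; elim/big_ind: _ => //; [apply: red_span_zero | apply: red_spanD].
Qed.

Lemma red_span_gen m a i b : (rank (a ++ lead i ++ b) < m)%N ->
  red_span m (word a * r i * word b).
Proof.
move=> lt; rewrite -[_ * _]scale1r -[_ *: _]addr0.
by apply: red_span_add1 => //; apply: red_span_zero.
Qed.

Lemma red_span_leq m n x : (m <= n)%N -> red_span m x -> red_span n x.
Proof.
move=> mn; elim=> [|k a i b z lt _ IH]; first exact: red_span_zero.
by apply: red_span_add1 => //; apply: leq_trans mn.
Qed.

Lemma red_span_words a b w x :
  red_span (rank w) x -> red_span (rank (a ++ w ++ b)) (word a * x * word b).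
Proof.
elim=> [|k c i e z lt _ IH]; first by rewrite mulr0 mul0r; apply: red_span_zero.
rewrite mulrDr mulrDl -pzscalerAr -pzscalerAl !mulrA wordM -mulrA wordM.
apply: red_span_add1 => //; rewrite -!catA.
by have := rank_mono a b lt; rewrite -!catA.
Qed.

(** The leading words have equal length, so none lies properly inside another and these are all the
    ambiguities. The case of empty u covers two relations with the same leading word. *)
Hypothesis overlap : forall i j u v, lead i ++ v = u ++ lead j ->
  (size u < d)%N ->
  red_span (rank (lead i ++ v)) (r i * word v - word u * r j).

Lemma r_tail i u : coef u (r i - word (lead i)) != 0 ->
  (rank u < rank (lead i))%N.
Proof.
rewrite raddfB /= coef_word; case: (eqVneq (lead i) u) => [<-|ne].
  by rewrite r_monic subrr eqxx.
by rewrite subr0 => /r_lower; apply; rewrite eq_sym.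
Qed.

(** The tail of [r_i] consists of words below [lead i]; expanding it and keeping [r_j] intact gives
    terms whose leading words are strictly smaller. The next lemma does the same with the two roles
    exchanged. *)
Lemma red_span_tailr a i m j b :
  red_span (rank (a ++ lead i ++ m ++ lead j ++ b))
    (word a * (r i - word (lead i)) * word m * r j * word b).
Proof.
set N := rank _.
apply: (@supp_ind _ _ _ (fun y => red_span N (word a * y * word m * r j * word b))).
  by rewrite mulr0 !mul0r; apply: red_span_zero.
move=> k u y ne IH; rewrite mulrDr !mulrDl -pzscalerAr -!pzscalerAl !wordM.
apply: red_span_add1 => //; rewrite -!catA; exact/rank_mono/r_tail.
Qed.

Lemma red_span_taill a i m j b :
  red_span (rank (a ++ lead i ++ m ++ lead j ++ b))
    (word a * r i * word m * (r j - word (lead j)) * word b).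
Proof.
set N := rank _.
apply: (@supp_ind _ _ _ (fun y => red_span N (word a * r i * word m * y * word b))).
  by rewrite mulr0 !mul0r; apply: red_span_zero.
move=> k u y ne IH; rewrite mulrDr !mulrDl -pzscalerAr -!pzscalerAl.
rewrite -[word a * r i * word m * word u * word b]mulrA wordM.
rewrite -[word a * r i * word m * _]mulrA wordM.
apply: red_span_add1 => //; rewrite /N [a ++ lead i ++ m ++ _]catA.
rewrite [(a ++ _) ++ m ++ _]catA [a ++ lead i ++ _]catA [(a ++ _) ++ m ++ _]catA.
exact/rank_mono/r_tail.
Qed.

Lemma red_span_same_lead_leq a i b a' j b' : (size a <= size a')%N ->
  a ++ lead i ++ b = a' ++ lead j ++ b' ->
  red_span (rank (a ++ lead i ++ b)) (word a * r i * word b - word a' * r j * word b').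
Proof.
move=> le e; set u := drop (size a) a'.
have {}e' : a' = a ++ u.
  rewrite -[a'](cat_take_drop (size a)) -/u; congr (_ ++ _).
  by have := congr1 (take (size a)) e; rewrite take_size_cat // takel_cat.
have {}e : lead i ++ b = u ++ lead j ++ b'.
  apply/eqP; have /eqP := e; rewrite e' -catA eqseq_cat //.
  by case/andP.
(* The word u is the shift between the two occurrences: if it is shorter than d they overlap and the
   hypothesis applies; otherwise they are disjoint. *)
rewrite e' -wordM -!mulrA -mulrBr; case: (ltnP (size u) d) => hu.
  pose v := take (size u) b.
  have ev : lead i ++ v = u ++ lead j.
    have /eqP := congr1 (take (size u + d)) e.
    rewrite [u ++ _]catA [in X in _ == X]take_size_cat ?size_cat ?size_lead //.
    by rewrite addnC -(size_lead i) take_cat ltnNge leq_addr addKn => /eqP.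
  have eb : b = v ++ b'.
    apply/eqP; have /eqP := e; rewrite catA -ev -catA eqseq_cat // eqxx.
    by [].
  rewrite eb -wordM !mulrA -mulrBl.
  have := @red_span_words a b' _ _ (overlap ev hu).
  by rewrite mulrA -!catA.
pose m := drop d u.
have eu : u = lead i ++ m.
  rewrite -[u](cat_take_drop d) -/m; congr (_ ++ _).
  by have := congr1 (take d) e; rewrite take_size_cat // takel_cat.
have eb : b = m ++ lead j ++ b'.
  by apply/eqP; have /eqP := e; rewrite eu -catA eqseq_cat // eqxx.
rewrite eb eu -!wordM.
(* With tails [t = r - lead], one has [r_i m lead_j - lead_i m r_j = t_i m r_j - r_i m t_j]: the
   products [r_i m r_j] cancel and each remaining summand contains a tail. *)
rewrite (_ : word a * _ = word a * r i * word m * (word (lead j) - r j) * word b' +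
  word a * (r i - word (lead i)) * word m * r j * word b'); last first.
  by rewrite !(mulrBl, mulrBr) !mulrA addrA subrK.
apply: red_spanD; last exact: red_span_tailr.
rewrite -[word (lead j) - _]opprB mulrN mulNr -scaleN1r.
by apply/red_spanZ/red_span_taill.
Qed.

Lemma red_span_same_lead a i b a' j b' :
  a ++ lead i ++ b = a' ++ lead j ++ b' ->
  red_span (rank (a ++ lead i ++ b)) (word a * r i * word b - word a' * r j * word b').
Proof.
move=> e; case: (leqP (size a) (size a')) => [le|/ltnW le].
  exact: red_span_same_lead_leq.
rewrite e -opprB -scaleN1r; apply: red_spanZ; exact: red_span_same_lead_leq.
Qed.

Lemma coef_red_span m x u : red_span m x -> (m <= rank u)%N -> coef u x = 0.
Proof.
move=> h mu; elim: h => [|k a i b z lt _ IH]; first by rewrite raddf0.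
rewrite fcoefD IH addr0 fcoefZ; case: (eqVneq (coef u (word a * r i * word b)) 0) => [->|].
  by rewrite mulr0.
case/coef_words_neq0 => v e h; suff: (rank u <= rank (a ++ lead i ++ b))%N by lia.
rewrite e; have [->//|ne] := eqVneq v (lead i).
by apply/ltnW/rank_mono/(r_lower h).
Qed.

Lemma red_span_split m x : red_span m.+1 x -> red_span m x \/
  exists k a i b y, [/\ rank (a ++ lead i ++ b) = m, red_span m y &
    x = k *: (word a * r i * word b) + y].
Proof.
elim=> [|k a i b z lt _ IH]; first by left; apply: red_span_zero.
move: lt; rewrite ltnS leq_eqVlt => /orP[/eqP e|lt].
  (* A second term at rank m is replaced by the one already present; the difference of the two is
     pushed into the lower part. *)
  right; case: IH => [hz|[k' [a' [j [b' [y [e' hy ->]]]]]]].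
    by exists k, a, i, b, z.
  exists (k + k'), a', j, b'.
  exists (k *: (word a * r i * word b - word a' * r j * word b') + y); split=> //.
    apply: red_spanD => //; apply: red_spanZ; rewrite -e; apply: red_span_same_lead.
    by apply: rank_inj; rewrite e.
  by rewrite scalerBr scalerDl !addrA; congr (_ + y); rewrite -addrA [RHS]addrC addrA subrK.
case: IH => [hz|[k' [a' [j [b' [y [e' hy ->]]]]]]].
  by left; apply: red_span_add1.
right; exists k', a', j, b', (k *: (word a * r i * word b) + y); split=> //.
  exact: red_span_add1.
by rewrite addrCA.
Qed.

Lemma rank_lt_size n u : (rank u < s.+2 ^ n)%N -> (size u <= n)%N.
Proof.
case: u => // i u h; rewrite ltnNge; apply/negP => nu.
have : (s.+2 ^ n <= s.+2 ^ size u)%N by rewrite leq_pexp2l.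
by move/leq_trans/(_ (rank_ge i u)); rewrite leqNgt h.
Qed.

(* The terms with leading word of rank m can only cancel among themselves, and
   they are all equal modulo lower terms. *)
Lemma red_span_pred m x :
  red_span m.+1 x -> (forall u, rank u = m -> coef u x = 0) -> red_span m x.
Proof.
case/red_span_split => // -[k [a [i [b [y [e hy ->]]]]]] /(_ _ e).
rewrite fcoefD fcoefZ coef_words r_monic mulr1 (coef_red_span hy) ?e // addr0 => ->.
by rewrite scale0r add0r.
Qed.

(** The words of length at most n are exactly those of rank below (s + 2)^n. At any higher rank the
    coefficient of x is zero, so [red_span_pred] lowers the bound one unit at a time. *)
Lemma red_span_deg_le m n x :
  red_span m x -> deg_le n x -> red_span (s.+2 ^ n) x.
Proof.
move=> h hx; case: (leqP m (s.+2 ^ n)) => [le|/ltnW le]; first exact: red_span_leq h.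
rewrite -(subnK le) in h; elim: (m - _)%N h => [//|k IH] h.
apply/IH/red_span_pred => // u eu; apply/eqP/negPn/negP => /hx un.
have := rank_lt u; rewrite eu ltnNge (leq_trans _ (leq_addl _ _)) //.
by rewrite leq_pexp2l.
Qed.

Lemma red_span_ideal m x y z : red_span m x -> exists n, red_span n (y * x * z).
Proof.
move=> hx; elim/(free_ind T): y => [|k u y [n IH]].
  by exists m; rewrite !mul0r; apply: red_span_zero.
suff [p hp] : exists p, red_span p (word u * x * z).
  exists (maxn p n); rewrite !mulrDl -!pzscalerAl.
  by apply: red_spanD; [apply/red_spanZ; apply: red_span_leq hp |
    apply: red_span_leq IH]; rewrite leq_max leqnn ?orbT.
clear n IH; elim/(free_ind T): z => [|c v z [n IH]].
  by exists m; rewrite !mulr0; apply: red_span_zero.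
suff [p hp] : exists p, red_span p (word u * x * word v).
  exists (maxn p n); rewrite mulrDr -pzscalerAr.
  by apply: red_spanD; [apply/red_spanZ; apply: red_span_leq hp |
    apply: red_span_leq IH]; rewrite leq_max leqnn ?orbT.
clear n IH; elim: hx => [|c' a i b w _ _ [p IH]].
  by exists m; rewrite mulr0 mul0r; apply: red_span_zero.
exists (maxn (rank ((u ++ a) ++ lead i ++ b ++ v)).+1 p).
rewrite mulrDr mulrDl -pzscalerAr -pzscalerAl !mulrA wordM -mulrA wordM.
apply: red_span_add1; first by rewrite leq_max ltnS leqnn.
by apply: red_span_leq IH; rewrite leq_max leqnn orbT.
Qed.

Lemma gen_ideal_red_span x :
  gen_ideal (fun y : T => exists i, y = r i) x -> exists m, red_span m x.
Proof.
move=> hx; apply: (hx (fun x => exists m, red_span m x)) => [|y [i ->]]; last first.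
  exists (rank (lead i)).+1; rewrite -[r i]mulr1 -[r i]mul1r -(word_nil T).
  by apply: red_span_gen; rewrite cats0.
split=> [|y z [m hm] [n hn]|y z w [m hm]]; first by exists 0%N; apply: red_span_zero.
- exists (maxn m n).
  by apply: red_spanD; [apply: red_span_leq hm | apply: red_span_leq hn];
    rewrite leq_max leqnn ?orbT.
- exact: red_span_ideal hm.
Qed.

(** In a representation bounded by (s + 2)^n each term [a r_i b] has length at most n. Terms of
    length n contribute a multiple of the top part of [r_i], shorter ones contribute nothing in
    degree n. *)
Lemma gen_ideal_hcomp n x :
  gen_ideal (fun y : T => exists i, y = r i) x -> deg_le n x ->
  gen_ideal (fun y : T => exists i, y = hcomp T d (r i)) (hcomp T n x).
Proof.
move=> /gen_ideal_red_span[m h] /(red_span_deg_le h){m h}.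
set J := gen_ideal _; have [J0 JD JM] := idealP J.
elim=> [|k a i b y lt _ IH]; first by rewrite linear0.
have r_deg : deg_le d (r i).
  move=> u hu; have [->|ne] := eqVneq u (lead i); first by rewrite size_lead.
  have lt' := r_lower hu ne; rewrite leqNgt -(size_lead i).
  by apply/negP => /rank_size; rewrite ltnNge ltnW.
rewrite linearP; apply: JD => //; apply: gen_idealZ.
have := rank_lt_size lt; rewrite !size_cat size_lead addnA leq_eqVlt.
case/orP=> [/eqP<-|ltn].
  by rewrite hcomp_words; apply: JM => I [_ _ _] hI; apply: hI; exists i.
by rewrite (hcomp_deg_le (deg_le_words (a := a) (b := b) r_deg)).
Qed.

End Groebner.

(** * Yang-Mills relations of a diagonal form *)

Section YangMillsElements.
Variables (K : fieldType) (s : nat) (T : free_alg K s) (h : 'M[K]_s.+1).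
Local Notation I := 'I_s.+1.
Local Notation word := (word T).
Local Notation coef := (coef T).

(** Has the shape of [YM_W], so that on [tensor_free] with h the inverse of g the two agree by
    conversion. *)
Definition ymW (r : I) : T :=
  \sum_l \sum_m \sum_n
    (h r l * h m n + h r n * h l m - 2%:R * h r m * h l n) *:
      (word [:: l] * word [:: m] * word [:: n]).

Lemma coef_ymW r a b c : coef [:: a; b; c] (ymW r) =
  h r a * h b c + h r c * h a b - 2%:R * h r b * h a c.
Proof.
rewrite /ymW raddf_sum (bigD1 a) //= [X in _ + X]big1 ?addr0; last first.
  move=> l /negbTE nl; rewrite raddf_sum /= big1 // => m _.
  rewrite raddf_sum /= big1 // => n _.
  by rewrite fcoefZ !wordM coef_word /= eqseq_cons nl mulr0.
rewrite raddf_sum (bigD1 b) //= [X in _ + X]big1 ?addr0; last first.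
  move=> l /negbTE nl; rewrite raddf_sum /= big1 // => n _.
  by rewrite fcoefZ !wordM coef_word /= !eqseq_cons nl andbF mulr0.
rewrite raddf_sum (bigD1 c) //= [X in _ + X]big1 ?addr0; last first.
  move=> l /negbTE nl.
  by rewrite fcoefZ !wordM coef_word /= !eqseq_cons nl !andbF mulr0.
by rewrite fcoefZ !wordM coef_word eqxx mulr1.
Qed.

Lemma hcomp_ymW r : hcomp T 3 (ymW r) = ymW r.
Proof.
rewrite /ymW linear_sum; apply: eq_bigr => l _.
rewrite linear_sum; apply: eq_bigr => m _.
rewrite linear_sum; apply: eq_bigr => n _.
by rewrite linearZ /= !wordM hcomp_word scale1r.
Qed.

End YangMillsElements.

Section Diagonal.
Variables (K : fieldType) (s : nat) (T : free_alg K s.+1).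
Local Notation I := 'I_s.+2.
Local Notation word := (word T).
Local Notation coef := (coef T).
Variables (e : I -> K) (e_neq0 : forall i, e i != 0).
Local Notation h := (diag_mx (\row_i e i)).
Variables (r : I -> T) (c : I -> K).
Hypothesis r_top : forall i, deg_le 2 (r i - ymW T h i).
Hypothesis r_comm :
  \sum_i (r i * word [:: i] - word [:: i] * r i) = \sum_i c i *: r i.

Local Notation i1 := (lift ord0 ord0 : I).

(* The leading words 011 and 00i of the relations W^0 and W^i. *)
Definition ym_lead (i : I) : seq I :=
  if i == ord0 then [:: ord0; i1; i1] else [:: ord0; ord0; i].

Definition ym_lead_coef i := e ord0 * (if i == ord0 then e i1 else e i).

Lemma ym_lead_coef_neq0 i : ym_lead_coef i != 0.
Proof. by rewrite /ym_lead_coef mulf_neq0 //; case: ifP. Qed.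

Lemma size_ym_lead i : size (ym_lead i) = 3%N.
Proof. by rewrite /ym_lead; case: ifP. Qed.

Lemma ym_lead_inj : injective ym_lead.
Proof.
move=> i j; rewrite /ym_lead; case: eqP => [->|ni]; case: eqP => [->|nj] // -[] //.
Qed.

Lemma coef_r3 i u : size u = 3%N -> coef u (r i) = coef u (ymW T h i).
Proof.
move=> su; apply/eqP; rewrite -subr_eq0 -raddfB; apply/negPn/negP => /r_top.
by rewrite su.
Qed.

Lemma diag_e a b : h a b = (a == b)%:R * e a.
Proof. by rewrite mxE mxE mulr_natl. Qed.

Lemma coef_diag i a b d : coef [:: a; b; d] (ymW T h i) =
  e i * ((i == a)%:R * (b == d)%:R * e b + (i == d)%:R * (a == b)%:R * e a
    - 2%:R * (i == b)%:R * (a == d)%:R * e a).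
Proof. by rewrite coef_ymW !diag_e; ring. Qed.

Lemma coef_ym_lead i : coef (ym_lead i) (r i) = ym_lead_coef i.
Proof.
rewrite coef_r3 ?size_ym_lead // /ym_lead /ym_lead_coef; case: eqP => [->|/eqP/negbTE ni].
  by rewrite coef_diag !eqxx /=; ring.
by rewrite coef_diag !eqxx ni /=; ring.
Qed.

Lemma rank_head (i j : I) u v : (j < i)%N -> size u = size v ->
  (rank (i :: u) < rank (j :: v))%N.
Proof.
move=> ji suv; rewrite -cat1s -[j :: v]cat1s !rank_cat !rank1 suv.
have := rank_lt u; rewrite suv => lu.
have li := ltn_ord i; have lj := ltn_ord j.
have : ((s.+2 - i).+1 * s.+3 ^ size v <= (s.+2 - j) * s.+3 ^ size v)%N.
  rewrite leq_mul2r; apply/orP; right; lia.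
rewrite mulSn; lia.
Qed.

(** Here [W^i = e_i sum_b e_b (x_i x_b x_b + x_b x_b x_i - 2 x_b x_i x_b)]. For i > 0 the summand b
    = 0 supplies 00i. For i = 0 that summand cancels, since 1 + 1 - 2 = 0, and the largest remaining
    word is 011. *)
Lemma coef_lower i u : coef u (r i) != 0 -> u != ym_lead i ->
  (rank u < rank (ym_lead i))%N.
Proof.
case: (ltngtP (size u) 3) => [lt _ _|gt|su].
- by apply: rank_size; rewrite size_ym_lead.
- have e0 : coef u (ymW T h i) = 0 by rewrite -hcomp_ymW coef_hcomp gtn_eqF.
  move=> hu _; have : coef u (r i - ymW T h i) != 0 by rewrite raddfB /= e0 subr0.
  by move/r_top; lia.
rewrite coef_r3 //; case: u su => // a [//|b [//|d [] // _]].
have pos (x : I) : x != ord0 -> (@ord0 s.+1 < x)%N by rewrite lt0n.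
have lt1 (x : I) : x != ord0 -> x != i1 -> (i1 < x)%N.
  by case: x => -[|[|x]] //.
rewrite coef_diag /ym_lead; case: (eqVneq i ord0) => [->|ni0].
  case: (eqVneq a ord0) => [->|na0 _ _]; last exact: rank_head (pos _ na0) _.
  case: (eqVneq b ord0) => [->|nb0].
    by rewrite (_ : e _ * _ = 0) ?eqxx //=; ring.
  case: (eqVneq b d) => [<-|nbd]; last first.
    by rewrite (_ : e _ * _ = 0) ?eqxx //=; ring.
  move=> _; case: (eqVneq b i1) => [->|nb1 _]; first by rewrite eqxx.
  apply: (@rank_mono _ [:: ord0] [::] [:: b; b] [:: i1; i1]).
  exact: rank_head (lt1 _ nb0 nb1) _.
case: (eqVneq a ord0) => [->|na0 _ _]; last exact: rank_head (pos _ na0) _.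
case: (eqVneq b ord0) => [->|nb0 _ _]; last first.
  apply: (@rank_mono _ [:: ord0] [::] [:: b; d] [:: ord0; i]).
  exact: rank_head (pos _ nb0) _.
rewrite (negbTE ni0); case: (eqVneq i d) => [->|nid]; first by rewrite eqxx.
by rewrite (_ : e _ * _ = 0) ?eqxx //=; ring.
Qed.

Definition ym_monic i : T := (ym_lead_coef i)^-1 *: r i.

Lemma r_lead i : r i = ym_lead_coef i *: ym_monic i.
Proof. by rewrite /ym_monic scalerA mulfV ?ym_lead_coef_neq0 // scale1r. Qed.

Lemma hcomp_ym_monic i : hcomp T 3 (ym_monic i) = (ym_lead_coef i)^-1 *: ymW T h i.
Proof.
rewrite /ym_monic linearZ -[r i](subrK (ymW T h i)) linearD /= hcomp_ymW.
by rewrite (hcomp_deg_le (r_top (i := i))) // add0r.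
Qed.

Lemma coef_ym_monic_lead i : coef (ym_lead i) (ym_monic i) = 1.
Proof. by rewrite /ym_monic fcoefZ coef_ym_lead mulVf ?ym_lead_coef_neq0. Qed.

Lemma coef_ym_monic_lower i u : coef u (ym_monic i) != 0 -> u != ym_lead i ->
  (rank u < rank (ym_lead i))%N.
Proof.
by rewrite /ym_monic fcoefZ mulf_eq0 negb_or => /andP[_]; apply: coef_lower.
Qed.

Lemma red_span_rl m a i b : (rank (a ++ ym_lead i ++ b) < m)%N ->
  red_span ym_lead ym_monic m (word a * r i * word b).
Proof.
move=> lt; rewrite r_lead -pzscalerAr -pzscalerAl.
by apply: red_spanZ; apply: red_span_gen.
Qed.

(** Solve [r_comm] for [r_1 x_1 - x_0 r_0]. What remains lies below 0011: the [c_i r_i] are shorter,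
    [x_i r_i] with i > 0 starts with a smaller letter, and [r_i x_i] with i different from 1 has
    leading word 0110 or 00ii with i > 1. *)
Lemma red_span_overlap :
  red_span ym_lead ym_monic (rank [:: ord0; ord0; i1; i1])
    (ym_monic i1 * word [:: i1] - word [:: ord0] * ym_monic ord0).
Proof.
(* Both relations have leading coefficient [e ord0 * e i1], so one scalar normalises the whole
   difference. *)
have -> : ym_monic i1 * word [:: i1] - word [:: ord0] * ym_monic ord0 =
    (e ord0 * e i1)^-1 *: (\sum_i c i *: r i
      + \sum_(i | i != ord0) word [:: i] * r i
      - \sum_(i | i != i1) r i * word [:: i]).
  rewrite -r_comm sumrB [\sum_i r i * _](bigD1 i1) //=.
  rewrite [\sum_i word _ * _](bigD1 ord0) //=.
  have cancel (A B C D : T) : A + B - (C + D) + D - B = A - C.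
    by rewrite opprD addrA subrK [A + B]addrC -addrA [B + _]addrC addrK.
  rewrite cancel.
  by rewrite scalerBr pzscalerAl pzscalerAr.
apply: red_spanZ; apply: red_spanB; first apply: red_spanD.
- apply: red_span_sum => i _; apply: red_spanZ.
  rewrite -[r i]mulr1 -[r i]mul1r -(word_nil T); apply: red_span_rl.
  by apply: rank_size; rewrite cats0 size_ym_lead.
- apply: red_span_sum => i ni; rewrite -[_ * _]mulr1 -(word_nil T).
  apply: red_span_rl; rewrite cats0; apply: (@rank_head _ _ _ [:: ord0; i1; i1]).
    by rewrite lt0n.
  by rewrite size_ym_lead.
- apply: red_span_sum => i ni; rewrite -[r i]mul1r -(word_nil T).
  apply: red_span_rl; rewrite /ym_lead; case: eqP => [->|/eqP ni0].
    apply: (@rank_mono _ [:: ord0] [::] [:: i1; i1; ord0] [:: ord0; i1; i1]).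
    exact: rank_head.
  apply: (@rank_mono _ [:: ord0; ord0] [::] [:: i; i] [:: i1; i1]).
  by apply: rank_head => //; move: ni ni0; case: i => -[|[|i]].
Qed.

Lemma diag_ideal_hcomp n x :
  gen_ideal (fun y : T => exists i, y = r i) x -> deg_le n x ->
  gen_ideal (fun y : T => exists i, y = ymW T h i) (hcomp T n x).
Proof.
move=> hx hn.
have {}hx : gen_ideal (fun y : T => exists i, y = ym_monic i) x.
  apply: gen_ideal_sub hx => _ [i ->]; rewrite r_lead; apply: gen_idealZ.
  by apply: gen_ideal_gen; exists i.
apply: gen_ideal_sub (gen_ideal_hcomp size_ym_lead coef_ym_monic_lead coef_ym_monic_lower _ hx hn).
  move=> _ [i ->].
  rewrite hcomp_ym_monic.
  by apply: gen_idealZ; apply: gen_ideal_gen; exists i.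
(* Shift 0 forces i = j. Shift 1 forces 00i followed by v to be a letter followed by 011, hence i =
   1 and j = 0. Shift 2 would need a leading word ending in the letter 0, and there is none. *)
move=> i j u v euv; case: u euv => [|a [|b [|//]]] euv _ /=.
- have ev : v = [::].
    have := congr1 size euv; rewrite size_cat !size_ym_lead /=.
    by case: (v) => // ? ?; rewrite addnS.
  rewrite ev cats0 in euv *; rewrite (ym_lead_inj euv) (word_nil T) mulr1 mul1r subrr.
  exact: red_span_zero.
- move: euv; rewrite {1 2 3}/ym_lead.
  case: (eqVneq i ord0) => [->|ni] //; case: (eqVneq j ord0) => [->|nj] //.
  by case=> <- -> ->; apply: red_span_overlap.
  by case=> _ ei; rewrite ei eqxx in ni.
- exfalso; have : nth ord0 (ym_lead i ++ v) 2 = ord0.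
    by rewrite euv /ym_lead /=; case: (j == ord0).
  rewrite /ym_lead; case: (eqVneq i ord0) => [_|ni] /= ei; first by [].
  by rewrite ei eqxx in ni.
Qed.

End Diagonal.

(** * Change of basis *)

Section Congruence.
Variables (K : fieldType).
Hypothesis two_neq0 : 2%:R != 0 :> K.

Lemma mul_delta_delta n (A : 'M[K]_n) k l :
  (delta_mx k 0 : 'cV[K]_n)^T *m A *m delta_mx l 0 = (A k l)%:M.
Proof. by rewrite trmx_delta -rowE -colE [LHS]mx11_scalar !mxE. Qed.

(** Polarisation: if the quadratic form of A vanished identically, its value at [e_i + e_j] would
    give [2 A_ij = 0]. *)
Lemma sym_anisotropic n (A : 'M[K]_n) : A^T = A -> A != 0 ->
  exists v : 'cV[K]_n, v^T *m A *m v != 0.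
Proof.
move=> symA; apply: contra_neqP => nv; apply/matrixP => i j.
have q0 (v : 'cV[K]_n) : v^T *m A *m v = 0.
  by apply/eqP/negPn/negP => h; apply: nv; exists v.
have := q0 (delta_mx i 0 + delta_mx j 0).
rewrite (raddfD trmx) !mulmxDl !mulmxDr !q0 addr0 add0r !mul_delta_delta.
have -> : A j i = A i j by rewrite -{1}symA mxE.
rewrite -raddfD -mulr2n -mulr_natl => /matrixP/(_ 0 0); rewrite !mxE mulr1n.
by move/eqP; rewrite mulf_eq0 (negbTE two_neq0) => /eqP.
Qed.

(* The elimination matrix [col_ebase v] completes v, up to a scalar, to a
   basis. *)
Lemma sym_congr_corner n (A : 'M[K]_(1 + n)) : A^T = A -> A != 0 ->
  exists2 Q, Q \in unitmx & (Q^T *m A *m Q) 0 0 != 0.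
Proof.
move=> symA /(sym_anisotropic symA)[v qv].
have v0 : v != 0 by apply: contraNneq qv => ->; rewrite mulmx0.
exists (col_ebase v); first exact: col_ebase_unit.
apply: contraNneq qv => e0; rewrite -{1 2}(mulmx_ebase v).
have -> : \rank v = 1%N.
  by apply/eqP; rewrite eqn_leq rank_leq_col lt0n mxrank_eq0.
have -> : pid_mx 1 = delta_mx 0 0 :> 'M[K]_(1 + n, 1).
  apply/matrixP => i j; rewrite !mxE ord1 andbT -val_eqE /= ltnS leqn0.
  by case: eqP => //= ->.
set Q := col_ebase v; set d := delta_mx 0 0.
have -> : (Q *m d *m row_ebase v)^T *m A *m (Q *m d *m row_ebase v) =
    (row_ebase v)^T *m (d^T *m (Q^T *m A *m Q) *m d) *m row_ebase v.
  by rewrite !trmx_mul !mulmxA.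
by rewrite mul_delta_delta e0 raddf0 mulmx0 mul0mx.
Qed.

Lemma sym_congr_diag n (A : 'M[K]_n) : A^T = A ->
  exists2 P, P \in unitmx & exists d : 'rV[K]_n, P^T *m A *m P = diag_mx d.
Proof.
elim: n A => [|n IH] A symA.
  exists 1%:M; first exact: unitmx1.
  by exists 0; rewrite [LHS]flatmx0 [RHS]flatmx0.
have [->|A0] := eqVneq A 0.
  exists 1%:M; first exact: unitmx1.
  by exists 0; rewrite mulmx0 mul0mx raddf0.
have [Q Qu] := @sym_congr_corner n A symA A0.
move EB: (Q^T *m A *m Q) => B B00.
have symB : B^T = B by rewrite -EB !trmx_mul trmxK symA mulmxA.
pose a := ulsubmx (B : 'M_(1 + n)); pose b := ursubmx (B : 'M_(1 + n)).
pose C := drsubmx (B : 'M_(1 + n)).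
have Ba : a = (B 0 0)%:M by rewrite [LHS]mx11_scalar !mxE; congr (B _ _)%:M; apply: val_inj.
have Bb : dlsubmx (B : 'M_(1 + n)) = b^T by rewrite /b trmx_ursub symB.
have eB : B = block_mx a b b^T C by rewrite -Bb submxK.
have symC : C^T = C by rewrite /C trmx_drsub symB.
(* The solution of [a t + b = 0]: the congruence by the unipotent matrix R below clears the border
   of B and leaves the Schur complement [C + b^T t], to which the induction applies. *)
pose t := - (B 0 0)^-1 *: b.
have at0 : a *m t + b = 0.
  by rewrite Ba mul_scalar_mx /t scalerA mulrN mulfV // scaleN1r addNr.
have ta0 : t^T *m a + b^T = 0.
  by rewrite -[a]trmxK -trmx_mul (_ : a^T = a) ?Ba ?tr_scalar_mx // -Ba -linearD at0 linear0.
have symC' : (C + b^T *m t)^T = C + b^T *m t.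
  by rewrite linearD /= symC trmx_mul trmxK /t linearZ /= -scalemxAl -scalemxAr.
have [P' P'u [d' ed']] := IH _ symC'.
pose R : 'M_(1 + n) := block_mx 1%:M t 0 1%:M.
pose P0 : 'M_(1 + n) := block_mx 1%:M 0 0 P'.
exists (Q *m R *m P0).
  rewrite !unitmx_mul Qu /=; apply/andP; split.
    by rewrite unitmxE (det_ublock 1%:M t 1%:M) !det1 mulr1 unitr1.
  by rewrite unitmxE (det_ublock (1%:M : 'M_1) 0 P') det1 mul1r -unitmxE.
exists (row_mx (B 0 0)%:M d').
have -> : (Q *m R *m P0)^T *m A *m (Q *m R *m P0) = P0^T *m (R^T *m B *m R) *m P0.
  by rewrite !trmx_mul -EB !mulmxA.
have -> : R^T *m B *m R = block_mx a 0 0 (C + b^T *m t).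
  rewrite eB /R tr_block_mx !trmx1 trmx0 !mulmx_block.
  rewrite !(mul1mx, mulmx1, mul0mx, mulmx0, addr0, add0r) at0 ta0 mul0mx add0r addrC.
  by congr (block_mx _ _ _ (_ + _)); rewrite /t linearZ /= -scalemxAl -scalemxAr.
rewrite /P0 tr_block_mx !trmx1 !trmx0 !mulmx_block.
rewrite !(mul1mx, mulmx1, mul0mx, mulmx0, addr0, add0r) ed' Ba.
apply: (etrans _ (esym (@diag_mx_row K n 1 (B 0 0)%:M d'))).
by congr block_mx; apply/matrixP => i j; rewrite !mxE !ord1.
Qed.

End Congruence.

(** * The universal property of the free algebra *)

Section Lift.
Variables (K : fieldType) (s : nat) (T : free_alg K s) (A : pzAlgType K).
Local Notation I := 'I_s.+1.
Local Notation word := (word T).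

Definition free_lift (y : I -> A) : {linear T -> A} :=
  sval (free_ext T (fun u => \prod_(l <- u) y l)).

Lemma free_lift_word y u : free_lift y (word u) = \prod_(l <- u) y l.
Proof. by rewrite /free_lift; case: free_ext => f /= ->. Qed.

Lemma free_lift_gen y l : free_lift y (word [:: l]) = y l.
Proof. by rewrite free_lift_word big_seq1. Qed.

Lemma free_lift1 y : free_lift y 1 = 1.
Proof. by rewrite -(word_nil T) free_lift_word big_nil. Qed.

Lemma free_morphM (f : {linear T -> A}) :
  (forall u v, f (word (u ++ v)) = f (word u) * f (word v)) ->
  {morph f : x z / x * z}.
Proof.
move=> fM x z; elim/(free_ind T): x => [|k u x IH].
  by rewrite mul0r linear0 mul0r.
rewrite mulrDl !linearD mulrDl IH; congr (_ + _).
elim/(free_ind T): z {IH x} => [|c v z IH]; first by rewrite mulr0 linear0 mulr0.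
rewrite mulrDr !linearD mulrDr IH; congr (_ + _).
by rewrite -pzscalerAl -pzscalerAr wordM !linearZ /= fM -pzscalerAl -pzscalerAr.
Qed.

Lemma free_liftM y : {morph free_lift y : x z / x * z}.
Proof. by apply: free_morphM => u v; rewrite !free_lift_word big_cat. Qed.

(** Stated for bare functions because it is applied to composites: two successive substitutions, and
    a ring morphism after a quotient map whose scalability is a separate hypothesis. *)
Lemma eq_free_alg_morph (f f' : T -> A) :
  linear f -> linear f' -> f 1 = 1 -> f' 1 = 1 ->
  {morph f : x y / x * y} -> {morph f' : x y / x * y} ->
  (forall l, f (word [:: l]) = f' (word [:: l])) -> f =1 f'.
Proof.
move=> fL f'L f1 f'1 fM f'M e.
have ew u : f (word u) = f' (word u).
  elim: u => [|l u IH]; first by rewrite word_nil f1 f'1.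
  by rewrite -cat1s -wordM fM f'M e IH.
have z (k : T -> A) : linear k -> k 0 = 0.
  by move=> kL; have := kL (-1) 0 0; rewrite scaler0 add0r scaleN1r addNr.
apply: (free_ind T) => [|k u x IH]; first by rewrite !z.
by rewrite fL f'L ew IH.
Qed.

End Lift.

Section Homogeneous.
Variables (K : fieldType) (s : nat) (T : free_alg K s).
Implicit Types x y : T.

Lemma hcomp_hcomp m n x : hcomp T m (hcomp T n x) = (m == n)%:R *: hcomp T n x.
Proof.
apply: coef_inj => u; rewrite fcoefZ !coef_hcomp.
case: (eqVneq m n) => [->|mn]; first by rewrite mul1r; case: ifP => // ->.
by rewrite mul0r; case: eqP => // ->; rewrite (negbTE mn).
Qed.

Lemma hcompM_homog m n x y : hcomp T m x = x -> hcomp T n y = y ->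
  hcomp T (m + n) (x * y) = x * y.
Proof.
move=> hx hy; rewrite hcompM.
have lt : (m < (m + n).+1)%N by rewrite ltnS leq_addr.
rewrite (bigD1 (Ordinal lt)) //= addKn hx hy big1 ?addr0 // => i.
rewrite -val_eqE /= => /negbTE ne; rewrite -hx hcomp_hcomp ne.
by rewrite scale0r mul0r.
Qed.

Lemma deg_leP n x : deg_le n x <-> (forall m, (n < m)%N -> hcomp T m x = 0).
Proof.
split=> [h m|h u]; first exact: hcomp_deg_le.
apply: contraNT; rewrite -ltnNge => /h e.
by have := coef_hcomp (size u) x u; rewrite e eqxx raddf0 => <-.
Qed.

Lemma deg_leD n x y : deg_le n x -> deg_le n y -> deg_le n (x + y).
Proof.
move=> /deg_leP hx /deg_leP hy; apply/deg_leP => m nm.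
by rewrite linearD hx // hy // addr0.
Qed.

Lemma deg_leZ n k x : deg_le n x -> deg_le n (k *: x).
Proof. by move=> /deg_leP hx; apply/deg_leP => m nm; rewrite linearZ hx //= scaler0. Qed.

Lemma deg_le0 n : deg_le n (0 : T).
Proof. by apply/deg_leP => m _; rewrite linear0. Qed.

Lemma hcomp_homog m n x : hcomp T n x = x -> hcomp T m x = (m == n)%:R *: x.
Proof. by move=> <-; rewrite hcomp_hcomp. Qed.

End Homogeneous.

Lemma mulmx1_comb (K : fieldType) n (V : lmodType K) (P Q : 'M[K]_n)
    (F : 'I_n -> V) i : P *m Q = 1%:M ->
  \sum_m Q m i *: (\sum_j P j m *: F j) = F i.
Proof.
move=> PQ; transitivity (\sum_j (P *m Q) j i *: F j).
  under eq_bigr => m _ do rewrite scaler_sumr.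
  rewrite exchange_big; apply: eq_bigr => j _; rewrite mxE scaler_suml.
  by apply: eq_bigr => m _; rewrite scalerA mulrC.
rewrite PQ (bigD1 i) //= mxE eqxx scale1r big1 ?addr0 // => j /negbTE nj.
by rewrite mxE nj scale0r.
Qed.

(** * Covariance of the relations under linear substitutions *)

Section LinearSubstitution.
Variables (K : fieldType) (s : nat) (T : free_alg K s).
Local Notation I := 'I_s.+1.
Local Notation word := (word T).
Implicit Types (P Q : 'M[K]_s.+1).

Definition lin_subst P : {linear T -> T} :=
  free_lift T (fun l => \sum_m P l m *: word [:: m]).

Lemma lin_subst_gen P l : lin_subst P (word [:: l]) = \sum_m P l m *: word [:: m].
Proof. exact: free_lift_gen. Qed.

Lemma lin_subst1 P : lin_subst P 1 = 1.
Proof. exact: free_lift1. Qed.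

Lemma lin_substM P : {morph lin_subst P : x y / x * y}.
Proof. exact: free_liftM. Qed.

Lemma hcomp_lin_subst P n x : hcomp T n (lin_subst P x) = lin_subst P (hcomp T n x).
Proof.
elim/(free_ind T): x => [|k u x IH]; first by rewrite !linear0.
rewrite !linearD IH; congr (_ + _); rewrite !linearZ; congr (_ *: _).
rewrite hcomp_word linearZ /=; rewrite (@hcomp_homog _ _ _ _ (size u)) 1?eq_sym //.
rewrite free_lift_word; elim: u => [|l u IHu].
  by rewrite big_nil -(word_nil T) hcomp_word scale1r.
rewrite big_cons; apply: (@hcompM_homog _ _ _ 1) => //.
by rewrite linear_sum; apply: eq_bigr => m _; rewrite linearZ /= hcomp_word scale1r.
Qed.

Lemma deg_le_lin_subst P n x : deg_le n x -> deg_le n (lin_subst P x).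
Proof.
by move/deg_leP => h; apply/deg_leP => m /h e; rewrite hcomp_lin_subst e linear0.
Qed.

Lemma lin_substK P Q : P *m Q = 1%:M -> cancel (lin_subst P) (lin_subst Q).
Proof.
move=> PQ; apply: (@eq_free_alg_morph _ _ _ _ (lin_subst Q \o lin_subst P) idfun) => //=.
- exact: linearP.
- by rewrite !lin_subst1.
- by move=> x y; rewrite /= !lin_substM.
move=> l; rewrite lin_subst_gen linear_sum /=.
have PQt : Q^T *m P^T = 1%:M by rewrite -trmx_mul PQ trmx1.
rewrite -[RHS](mulmx1_comb (fun m => word [:: m]) l PQt).
apply: eq_bigr => m _; rewrite linearZ /= lin_subst_gen mxE; congr (_ *: _).
by apply: eq_bigr => k _; rewrite mxE.
Qed.

Lemma gen_ideal_lin_subst P (X Y : T -> Prop) x :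
  (forall y, X y -> gen_ideal Y (lin_subst P y)) ->
  gen_ideal X x -> gen_ideal Y (lin_subst P x).
Proof.
move=> h hx; apply: (hx (fun x => gen_ideal Y (lin_subst P x))) => //.
have [Y0 YD YM] := idealP (gen_ideal Y).
split=> [|y z hy hz|a y b hy]; first by rewrite linear0.
- by rewrite linearD; apply: YD.
- by rewrite !lin_substM; apply: YM.
Qed.

Section Quadratic.
Variables (h : 'M[K]_s.+1).

(** The generator with raised index, followed by the contraction of [x_l y x_m] with h. The
    relations are built from these two, so covariance can be checked on each separately. *)
Definition upper (r : I) : T := \sum_l h r l *: word [:: l].
Definition sandwich (y : T) : T :=
  \sum_l \sum_m h l m *: (word [:: l] * y * word [:: m]).

Lemma sandwichD : {morph sandwich : x y / x + y}.
Proof.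
move=> x y; rewrite -big_split; apply: eq_bigr => l _.
rewrite -big_split; apply: eq_bigr => m _.
by rewrite /= mulrDr mulrDl scalerDr.
Qed.

Lemma sandwichZ k y : sandwich (k *: y) = k *: sandwich y.
Proof.
rewrite scaler_sumr; apply: eq_bigr => l _.
rewrite scaler_sumr; apply: eq_bigr => m _.
by rewrite -pzscalerAr -pzscalerAl !scalerA mulrC.
Qed.

Lemma sandwich_sum (F : I -> T) :
  sandwich (\sum_r F r) = \sum_r sandwich (F r).
Proof.
apply: (big_morph _ sandwichD); have := sandwichZ 0 0.
by rewrite !scale0r.
Qed.

(* [sandwich 1] is the quadratic element h^{lm} x_l x_m. *)
Lemma ymW_sandwich r : ymW T h r =
  upper r * sandwich 1 + sandwich 1 * upper r - 2%:R *: sandwich (upper r).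
Proof.
rewrite /ymW.
under eq_bigr => l _ do (under eq_bigr => m _ do (under eq_bigr => n _ do
  rewrite scalerBl scalerDl)).
under eq_bigr => l _ do (under eq_bigr => m _ do rewrite sumrB big_split /=).
under eq_bigr => l _ do rewrite sumrB big_split /=.
rewrite sumrB big_split /=; congr (_ + _ - _).
- rewrite /upper mulr_suml; apply: eq_bigr => l _.
  rewrite /sandwich mulr_sumr; apply: eq_bigr => m _.
  rewrite mulr_sumr; apply: eq_bigr => n _.
  by rewrite mulr1 -pzscalerAl -pzscalerAr scalerA mulrA.
- rewrite /sandwich mulr_suml; apply: eq_bigr => l _.
  rewrite mulr_suml; apply: eq_bigr => m _.
  rewrite /upper mulr_sumr; apply: eq_bigr => n _.
  by rewrite mulr1 -pzscalerAl -pzscalerAr scalerA mulrC.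
rewrite /sandwich scaler_sumr; apply: eq_bigr => l _.
rewrite exchange_big scaler_sumr; apply: eq_bigr => n _ /=.
rewrite /upper mulr_sumr mulr_suml !scaler_sumr; apply: eq_bigr => m _.
by rewrite -pzscalerAr -pzscalerAl !scalerA mulrAC.
Qed.

End Quadratic.

Lemma lin_subst_sandwich h P y : lin_subst P (sandwich h y) =
  sandwich (P^T *m h *m P) (lin_subst P y).
Proof.
rewrite /sandwich linear_sum /=.
transitivity (\sum_l \sum_m \sum_a \sum_b (P l a * h l m * P m b) *:
    (word [:: a] * lin_subst P y * word [:: b])).
  apply: eq_bigr => l _; rewrite linear_sum; apply: eq_bigr => m _ /=.
  rewrite linearZ /= !lin_substM !lin_subst_gen -mulrA mulr_suml.
  rewrite scaler_sumr; apply: eq_bigr => a _.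
  rewrite !mulr_sumr scaler_sumr; apply: eq_bigr => b _.
  rewrite -pzscalerAl -!pzscalerAr !scalerA mulrA; congr (_ *: _).
  by rewrite [h l m * _]mulrC.
(* The sums over m and l are nested in the order in which the entries of [P^T *m h *m P] unfold. *)
transitivity (\sum_a \sum_b \sum_m \sum_l (P l a * h l m * P m b) *:
    (word [:: a] * lin_subst P y * word [:: b])).
  rewrite exchange_big /=.
  under eq_bigr => m _ do rewrite exchange_big /=.
  rewrite exchange_big /=; apply: eq_bigr => a _.
  under eq_bigr => m _ do rewrite exchange_big /=.
  by rewrite exchange_big.
apply: eq_bigr => a _; apply: eq_bigr => b _.
rewrite mxE scaler_suml; apply: eq_bigr => m _.
rewrite mxE mulr_suml scaler_suml; apply: eq_bigr => l _.
by rewrite mxE.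
Qed.

Lemma lin_subst_upper h P m :
  \sum_r P r m *: lin_subst P (upper h r) = upper (P^T *m h *m P) m.
Proof.
transitivity (\sum_r \sum_l \sum_a (P r m * h r l * P l a) *: word [:: a]).
  apply: eq_bigr => r _; rewrite /upper linear_sum scaler_sumr.
  apply: eq_bigr => l _; rewrite linearZ /= lin_subst_gen !scaler_sumr.
  by apply: eq_bigr => a _; rewrite !scalerA.
rewrite exchange_big /=.
under eq_bigr => l _ do rewrite exchange_big /=.
rewrite exchange_big /=; apply: eq_bigr => a _.
rewrite mxE scaler_suml; apply: eq_bigr => l _.
rewrite mxE mulr_suml scaler_suml; apply: eq_bigr => r _.
by rewrite mxE.
Qed.

(** Substitution transforms only the contracted indices; the free index r of the relation must be
    recombined with P by hand to obtain a relation of the new form. *)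
Lemma lin_subst_ymW h P m :
  \sum_r P r m *: lin_subst P (ymW T h r) = ymW T (P^T *m h *m P) m.
Proof.
rewrite ymW_sandwich -lin_subst_upper.
have substE r : lin_subst P (ymW T h r) =
    lin_subst P (upper h r) * sandwich (P^T *m h *m P) 1 +
    sandwich (P^T *m h *m P) 1 * lin_subst P (upper h r) -
    2%:R *: sandwich (P^T *m h *m P) (lin_subst P (upper h r)).
  rewrite ymW_sandwich linearB linearD linearZ.
  by rewrite !lin_substM !lin_subst_sandwich lin_subst1.
under eq_bigr => r _ do rewrite substE scalerBr scalerDr.
rewrite sumrB big_split /=; congr (_ + _ - _).
- by rewrite mulr_suml; apply: eq_bigr => r _; rewrite pzscalerAl.
- by rewrite mulr_sumr; apply: eq_bigr => r _; rewrite pzscalerAr.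
rewrite sandwich_sum scaler_sumr; apply: eq_bigr => r _.
by rewrite sandwichZ !scalerA mulrC.
Qed.

End LinearSubstitution.

Section Transport.
Variables (K : fieldType) (s : nat) (T : free_alg K s.+1).
Local Notation I := 'I_s.+2.
Local Notation word := (word T).
Hypothesis two_neq0 : 2%:R != 0 :> K.

(** Substitution by an invertible P that diagonalises h commutes with homogeneous components, so the
    diagonal case is applied to the image of x and the result is pulled back along the inverse
    matrix. *)
Lemma ymW_ideal_hcomp (h : 'M[K]_s.+2) (r : I -> T) (c : I -> K) n x :
  h^T = h -> h \in unitmx ->
  (forall i, deg_le 2 (r i - ymW T h i)) ->
  \sum_i (r i * word [:: i] - word [:: i] * r i) = \sum_i c i *: r i ->
  gen_ideal (fun y : T => exists i, y = r i) x -> deg_le n x ->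
  gen_ideal (fun y : T => exists i, y = ymW T h i) (hcomp T n x).
Proof.
move=> symh uh r_top r_comm hx hn.
have [P Pu [d ed]] := sym_congr_diag two_neq0 symh.
have PV : P *m invmx P = 1%:M by rewrite mulmxV.
have d_neq0 i : d 0 i != 0.
  have : diag_mx d \in unitmx by rewrite -ed !unitmx_mul unitmx_tr Pu uh.
  rewrite unitmxE det_diag unitfE => /prodf_neq0; exact.
have eW i : ymW T (diag_mx (\row_j d 0 j)) i = ymW T (P^T *m h *m P) i.
  by rewrite ed; congr (ymW T (diag_mx _) i); apply/rowP => j; rewrite mxE.
pose r' m := \sum_i P i m *: lin_subst T P (r i).
have rr' i : lin_subst T P (r i) = \sum_m invmx P m i *: r' m.
  by rewrite (mulmx1_comb (fun j => lin_subst T P (r j)) i PV).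
pose c' m := \sum_i c i * invmx P m i.
(* The family r' is recombined by the matrix that transforms the generators, so the sum of the
   [r'_m x_m] is the image of the sum of the [r_i x_i]; the coefficients c' use the inverse matrix
   instead. *)
have r'_comm : \sum_m (r' m * word [:: m] - word [:: m] * r' m) = \sum_m c' m *: r' m.
  transitivity (lin_subst T P (\sum_i c i *: r i)).
    rewrite -r_comm linear_sum /=.
    under [RHS]eq_bigr do rewrite linearB /= !lin_substM !lin_subst_gen.
    rewrite !sumrB; congr (_ - _).
      under eq_bigr do rewrite mulr_suml.
      rewrite exchange_big; apply: eq_bigr => i _; rewrite mulr_sumr.
      by apply: eq_bigr => m _; rewrite -pzscalerAl -pzscalerAr.
    under eq_bigr do rewrite mulr_sumr.
    rewrite exchange_big; apply: eq_bigr => i _; rewrite mulr_suml.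
    by apply: eq_bigr => m _; rewrite -pzscalerAl -pzscalerAr.
  rewrite linear_sum.
  under eq_bigr => i _ do rewrite linearZ /= rr' scaler_sumr.
  rewrite exchange_big; apply: eq_bigr => m _; rewrite scaler_suml.
  by apply: eq_bigr => i _; rewrite scalerA.
have r'_top m : deg_le 2 (r' m - ymW T (diag_mx (\row_j d 0 j)) m).
  rewrite eW -lin_subst_ymW -sumrB; elim/big_ind: _ => [|y z|i _].
  - exact: deg_le0.
  - exact: deg_leD.
  by rewrite -scalerBr -linearB; apply/deg_leZ/deg_le_lin_subst.
have hy : gen_ideal (fun y : T => exists i, y = r' i) (lin_subst T P x).
  apply: gen_ideal_lin_subst hx => _ [i ->]; rewrite rr'; apply: ideal_sum => m _.
  by apply: gen_idealZ; apply: gen_ideal_gen; exists m.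
have := diag_ideal_hcomp d_neq0 r'_top r'_comm hy (deg_le_lin_subst hn).
rewrite hcomp_lin_subst -[X in _ -> gen_ideal _ X](lin_substK PV).
apply: gen_ideal_lin_subst => _ [m ->]; rewrite eW -lin_subst_ymW linear_sum.
apply: ideal_sum => i _.
have -> : lin_subst T (invmx P) (P i m *: lin_subst T P (ymW T h i)) = P i m *: ymW T h i.
  by rewrite linearZ /= (lin_substK PV).
by apply: gen_idealZ; apply: gen_ideal_gen; exists i.
Qed.

End Transport.

(** * The PBW property and leading parts *)

Section PBW.
Variables (K : fieldType) (s : nat) (T : free_alg K s).
Local Notation I := 'I_s.+1.
Local Notation word := (word T).
Local Notation hcomp := (hcomp T).
Implicit Types x y : T.

Lemma deg_le_exists x : exists n, deg_le n x.
Proof.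
elim/(free_ind T): x => [|k u x [n hn]]; first by exists 0%N; apply: deg_le0.
exists (maxn (size u) n); apply: deg_leD => [|v /hn]; last first.
  by rewrite leq_max => ->; rewrite orbT.
apply: deg_leZ => v; rewrite coef_word; case: (eqVneq u v) => [-> _|].
  by rewrite leq_max leqnn.
by rewrite eqxx.
Qed.

Lemma hcomp_sum n x : deg_le n x -> x = \sum_(i < n.+1) hcomp i x.
Proof.
move=> hx; apply: coef_inj => u; rewrite raddf_sum /=.
under eq_bigr do rewrite coef_hcomp.
have [lt|ge] := ltnP (size u) n.+1.
  rewrite (bigD1 (Ordinal lt)) //= eqxx big1 ?addr0 // => i.
  by rewrite -val_eqE eq_sym => /negbTE /= ->.
rewrite big1 => [|i _]; last first.
  by rewrite gtn_eqF // (leq_trans (ltn_ord i)).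
by apply/eqP/negPn/negP => /hx; rewrite leqNgt ge.
Qed.

Lemma deg_le_top n x : deg_le n.+1 x -> deg_le n (x - hcomp n.+1 x).
Proof.
move=> /deg_leP hx; apply/deg_leP => m nm; rewrite linearB hcomp_hcomp.
case: eqVneq => [->|ne]; first by rewrite scale1r subrr.
by rewrite scale0r subr0 hx // ltn_neqAle eq_sym ne.
Qed.

Lemma deg_le_hcomp n x : deg_le n (hcomp n x).
Proof.
apply/deg_leP => m nm; rewrite hcomp_hcomp gtn_eqF //.
by rewrite scale0r.
Qed.

Variables (J : ideal T) (F : filtration T).
Hypothesis FP : forall n x, reflect (deg_le n x) (x \in F n).
Local Notation B := (quot_alg J).
Local Notation FB := (quot_filtration F J).

Lemma quot_pi_fil n x : deg_le n x -> quot_pi J x \in FB n.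
Proof. by move=> /FP xF; apply/quot_filP; exists x. Qed.

(* The canonical map T(E) -> A -> gr(A_phi), through the Rees algebra. *)
Definition symbol_series x : series B := fun n => quot_pi J (hcomp n x).

Lemma symbol_rees x : symbol_series x \in rees_pred FB.
Proof.
apply/asboolP; split=> [n|]; first exact/quot_pi_fil/deg_le_hcomp.
have [N hN] := deg_le_exists x; exists N.+1 => n Nn.
by rewrite /symbol_series (hcomp_deg_le hN) // raddf0.
Qed.

Definition symbol x : gr FB :=
  quot_pi (Ideal (@rees_lowP _ _ FB)) (Rees (symbol_rees x)).

Lemma symbol_linear : linear symbol.
Proof.
move=> k x y; rewrite /symbol -linearP; congr quot_pi.
by apply: val_inj; apply/funext => n; rewrite /= /symbol_series !linearP.
Qed.

HB.instance Definition _ :=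
  GRing.isLinear.Build K T (gr FB) *:%R symbol symbol_linear.

Lemma symbol1 : symbol 1 = 1.
Proof.
rewrite /symbol -[RHS](rmorph1 (quot_pi _)); congr quot_pi.
apply: val_inj; apply/funext => n; rewrite /= /symbol_series.
rewrite -(word_nil T) hcomp_word word_nil linearZ rmorph1 /= eq_sym.
by rewrite [RHS]ser1E scaler_nat.
Qed.

Lemma symbolM : {morph symbol : x y / x * y}.
Proof.
move=> x y; rewrite /symbol -rmorphM; congr quot_pi.
apply: val_inj; apply/funext => n; rewrite /= /symbol_series hcompM raddf_sum.
rewrite [RHS]serME; apply: eq_bigr => i _; exact: rmorphM.
Qed.

Lemma symbol_eq0 x :
  symbol x = 0 <-> forall n, quot_pi J (hcomp n x) \in fil_pred FB n.
Proof.
rewrite /symbol -[X in _ = X](raddf0 (quot_pi _)).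
split=> [/quot_eqP|h]; last apply/quot_eqP.
  by rewrite subr0 => /asboolP.
by rewrite subr0; apply/asboolP.
Qed.

Lemma symbol_gen l (h : quot_pi J (word [:: l]) \in FB 1%N) :
  symbol (word [:: l]) = gr_class h.
Proof.
congr quot_pi; apply: val_inj; apply/funext => n; rewrite /= /symbol_series.
by rewrite hcomp_word eq_sym; case: eqP; rewrite ?scale1r // scale0r raddf0.
Qed.

Variable X : T -> Prop.
(** A relation is homogeneous of positive degree and equals an element of lower degree modulo J,
    hence its symbol is zero. *)
Hypothesis X_low : forall x, X x -> exists n y,
  [/\ hcomp n.+1 x = x, deg_le n y & J (x - y)].
Hypothesis gen_fil : forall l, quot_pi J (word [:: l]) \in FB 1%N.

Lemma symbol_ideal x : gen_ideal X x -> symbol x = 0.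
Proof.
move=> h; apply: (h (fun x => symbol x = 0)); last first.
  move=> y /X_low[n [z [ey hz Jyz]]]; apply/symbol_eq0 => m.
  rewrite -ey hcomp_hcomp; case: eqVneq => [->|_]; last first.
    by rewrite scale0r raddf0 fil_pred0.
  rewrite scale1r ey (_ : quot_pi J y = quot_pi J z); first exact: quot_pi_fil.
  by apply/quot_eqP; apply/asboolP.
split=> [|y z ey ez|a y b ey].
- by apply/symbol_eq0 => n; rewrite linear0 raddf0 fil_pred0.
- by rewrite raddfD /= ey ez addr0.
- by rewrite !symbolM ey mulr0 mul0r.
Qed.

Definition leading_property := forall n x,
  deg_le n x -> J x -> gen_ideal X (hcomp n x).

(** If the class of a component of x of degree n + 1 falls into the step n of the filtration, then
    that component minus some y of degree at most n lies in J, and its leading part is the component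
    itself. In degree 0 the preceding step is zero. *)
Lemma symbol_inj x : leading_property -> symbol x = 0 -> gen_ideal X x.
Proof.
move=> L /symbol_eq0 h; have [N /hcomp_sum ->] := deg_le_exists x.
apply: ideal_sum => i _; have := h i.
case: (i : nat) => [/eqP e|n /quot_filP[y /FP hy e]].
  have := L 0%N (hcomp 0 x); rewrite hcomp_hcomp eqxx scale1r; apply.
    exact: deg_le_hcomp.
  by apply/asboolP; rewrite -[hcomp _ _]subr0; apply/quot_eqP; rewrite e raddf0.
have := L n.+1 (hcomp n.+1 x - y); rewrite linearB hcomp_hcomp eqxx scale1r.
rewrite (hcomp_deg_le hy) // subr0; apply.
  apply: deg_leD; first exact: deg_le_hcomp.
  rewrite -scaleN1r; apply: deg_leZ => u /hy /leqW //.
by apply/asboolP; apply/quot_eqP.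
Qed.

Lemma symbol_surj (v : gr FB) : exists x, symbol x = v.
Proof.
rewrite -[v]quot_reprK; move: (quot_repr v) => w {v}.
have /choice[x hx] n : exists x, deg_le n x /\ val w n = quot_pi J x.
  by have /quot_filP[x /FP xF e] := reesF w n; exists x.
have [N hN] : exists N, forall n, (N <= n)%N -> val w n = 0.
  by case: (w) => f hf; have /asboolP[] := hf.
(* Only the top component of each representative matters: the rest of [x n] has degree below n and
   dies in the associated graded algebra. *)
exists (\sum_(i < N) hcomp i (x i)); apply/quot_eqP/asboolP => n.
rewrite -[val _ n]/(quot_pi J (hcomp n (\sum_(i < N) hcomp i (x i))) - val w n).
rewrite linear_sum; have [lt|ge] := ltnP n N; last first.
  rewrite big1 => [|i _]; first by rewrite raddf0 hN // subr0 fil_pred0.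
  by rewrite hcomp_hcomp gtn_eqF ?scale0r // (leq_trans (ltn_ord i)).
rewrite (bigD1 (Ordinal lt)) //= hcomp_hcomp eqxx scale1r big1 ?addr0 => [|i ne].
  have [hn ->] := hx n; rewrite -raddfB.
  case: n hn {lt} => [|n] hn.
    rewrite (_ : _ - _ = 0) ?raddf0 ?fil_pred0 //.
    by rewrite {2}(hcomp_sum hn) big_ord1 subrr.
  rewrite -opprB -scaleN1r; apply: quot_pi_fil.
  exact/deg_leZ/deg_le_top.
by rewrite hcomp_hcomp eq_sym (negbTE (_ : val i != n)) ?scale0r.
Qed.

Lemma pbw_leading :
  (exists f : {rmorphism quot_alg (gen_ideal X) -> gr FB},
    [/\ scalable f,
        forall l, f (quot_pi _ (word [:: l])) = gr_class (gen_fil l)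
      & bijective f]) <-> leading_property.
Proof.
split=> [[f [fZ fg /bij_inj finj]]|L].
  (* The values on the generators determine f, so its injectivity is a statement about the kernel of
     [symbol]. *)
  have e : (fun x => f (quot_pi (gen_ideal X) x)) =1 symbol.
    apply: eq_free_alg_morph.
    - by move=> k x y; rewrite linearP rmorphD fZ.
    - exact: symbol_linear.
    - by rewrite !rmorph1.
    - exact: symbol1.
    - by move=> x y; rewrite !rmorphM.
    - exact: symbolM.
    - by move=> l; rewrite fg (symbol_gen (gen_fil l)).
  move=> n x hx Jx; apply/asboolP; rewrite -[hcomp n x]subr0; apply/quot_eqP.
  apply: finj; rewrite raddf0 rmorph0 e; apply/symbol_eq0 => m.
  rewrite hcomp_hcomp; case: eqVneq => [->|_]; last first.
    by rewrite scale0r raddf0 fil_pred0.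
  (* Since x is zero modulo J, its top component is congruent to minus the rest of x, which has
     lower degree. *)
  rewrite scale1r; have -> : quot_pi J (hcomp n x) = quot_pi J (hcomp n x - x).
    by apply/quot_eqP; rewrite opprB addrC subrK; apply/asboolP.
  case: n hx => [|n] hx.
    by rewrite {2}(hcomp_sum hx) big_ord1 subrr raddf0 fil_pred0.
  rewrite -opprB -scaleN1r; apply: quot_pi_fil.
  exact/deg_leZ/deg_le_top.
pose f (a : quot_alg (gen_ideal X)) : gr FB := symbol (quot_repr a).
have fE x : f (quot_pi _ x) = symbol x.
  have /asboolP/symbol_ideal := quot_piK (gen_ideal X) x.
  by rewrite raddfB /= => /eqP; rewrite subr_eq0 => /eqP ->.
have fB : zmod_morphism f.
  move=> a b; rewrite -[a]quot_reprK -[b]quot_reprK -raddfB !fE.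
  by rewrite raddfB.
have fM : monoid_morphism f.
  split; first by rewrite -(rmorph1 (quot_pi _)) fE symbol1.
  by move=> a b; rewrite -[a]quot_reprK -[b]quot_reprK -rmorphM !fE symbolM.
pose fAdd := GRing.isZmodMorphism.Build _ _ f fB.
pose fMul := GRing.isMonoidMorphism.Build _ _ f fM.
pose fR : {rmorphism quot_alg (gen_ideal X) -> gr FB} := HB.pack f fAdd fMul.
exists fR; split.
- by move=> k a; rewrite /= -[a]quot_reprK -linearZ !fE linearZ.
- by move=> l; rewrite /= fE symbol_gen.
have finj : injective f.
  move=> a b; rewrite -[a]quot_reprK -[b]quot_reprK !fE => e.
  apply/quot_eqP; rewrite idealbE; apply/asboolP; apply: symbol_inj => //.
  by rewrite raddfB /= e subrr.
have /choice[g gK] : forall v, exists a, f a = v.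
  by move=> v; have [x <-] := symbol_surj v; exists (quot_pi _ x).
by exists g => // a; apply: finj; rewrite gK.
Qed.

End PBW.

(** * The equations on the coefficients of phi *)

Section Equations.
Variables (K : fieldType) (s : nat) (h : 'M[K]_s.+1).
Local Notation I := 'I_s.+1.
Hypothesis two_neq0 : 2%:R != 0 :> K.
Hypothesis symh : h^T = h.
Variables (j3 : I -> I -> I -> K) (j2 : I -> I -> K) (j1 : I -> K).

(* The components of degrees 3, 2, 1 and 0 of
   sum_r [phi(W^r), nabla_r] = sum_r c_r (W^r - phi(W^r)). *)
Definition overlap_eqs (c : I -> K) : Prop :=
  [/\ forall a b d, j3 a b d - j3 b d a =
        \sum_i c i * (h i a * h b d + h i d * h a b - 2%:R * h i b * h a d),
      forall a b, j2 a b - j2 b a = - \sum_i c i * j3 a b i,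
      forall a, \sum_i c i * j2 a i = 0
    & \sum_i c i * j1 i = 0].

Definition pbw_solution (b : I -> K) (w s3 : I -> I -> I -> K) (s2 : I -> I -> K)
    (s1 : I -> K) : Prop :=
  [/\ antisymmetric3 w,
      symmetric3 s3 /\ (forall al be, \sum_r s3 al be r * b r = 0),
      (forall al be, s2 be al = s2 al be) /\
        (forall al, \sum_r s2 al r * b r = 0),
      \sum_r s1 r * b r = 0
    & [/\ forall al be ga, j3 al be ga =
            \sum_r (h al r * h be ga - h al ga * h be r) * b r
            + w al be ga + s3 al be ga,
          forall al be, j2 al be =
            - (2%:R^-1 * \sum_r w al be r * b r) + s2 al be
        & forall al, j1 al = s1 al]].

Let half : 2%:R^-1 + 2%:R^-1 = 1 :> K.
Proof. by apply: (mulfI two_neq0); rewrite mulrDr mulfV // mulr1. Qed.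

Lemma h_sym a b : h a b = h b a.
Proof. by rewrite -{1}symh mxE. Qed.

Definition raise (b : I -> K) a := \sum_r h a r * b r.

Lemma part_raise b al be ga :
  \sum_r (h al r * h be ga - h al ga * h be r) * b r =
  raise b al * h be ga - h al ga * raise b be.
Proof.
rewrite /raise mulr_suml mulr_sumr -sumrB; apply: eq_bigr => r _; ring.
Qed.

Lemma overlap_raise c a b d :
  \sum_i c i * (h i a * h b d + h i d * h a b - 2%:R * h i b * h a d) =
  raise c a * h b d + raise c d * h a b - 2%:R * raise c b * h a d.
Proof.
rewrite /raise mulr_sumr !mulr_suml -big_split -sumrB; apply: eq_bigr => i _ /=.
rewrite (h_sym a i) (h_sym d i) (h_sym b i); ring.
Qed.

(** Exchanging the two contracted indices shows that the sum is its own opposite. *)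
Lemma antisym3_contract (w : I -> I -> I -> K) b a : antisymmetric3 w ->
  \sum_i (\sum_r w a i r * b r) * b i = 0.
Proof.
move=> aw; set S := \sum_i _.
have : S = - S.
  rewrite {1}/S; under eq_bigr do rewrite mulr_suml.
  rewrite exchange_big /S -sumrN; apply: eq_bigr => i _ /=.
  rewrite mulr_suml -sumrN; apply: eq_bigr => r _.
  by have [_ -> _] := aw a i r; ring.
move/eqP; rewrite -subr_eq0 opprK -mulr2n -mulr_natl mulf_eq0 (negbTE two_neq0).
by move/eqP.
Qed.

(** With b raised, the contraction is [b^al b^be - b^al b^be]; contracting j3 with b therefore sees
    only the w and s3 parts. *)
Lemma part_contract b al be :
  \sum_i b i * (\sum_r (h al r * h be i - h al i * h be r) * b r) = 0.
Proof.
under eq_bigr do rewrite part_raise.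
rewrite (eq_bigr (fun i => raise b al * (h be i * b i) - raise b be * (h al i * b i))).
  by rewrite sumrB -!mulr_sumr -/(raise b be) -/(raise b al) mulrC subrr.
by move=> i _; ring.
Qed.

(** Both w and s3 are invariant under cyclic permutations, so they drop out of the degree 3 equation
    and the b part alone produces its right side. In degree 2 the factor one half is doubled by
    antisymmetrising. *)
Lemma solution_overlap b w s3 s2 s1 :
  pbw_solution b w s3 s2 s1 -> overlap_eqs b.
Proof.
case=> aw [ss3 s3b] [ss2 s2b] s1b [e3 e2 e1].
have j3b al be : \sum_i b i * j3 al be i = \sum_r w al be r * b r.
  under eq_bigr => i _ do rewrite e3 !mulrDr.
  rewrite !big_split /= part_contract add0r.
  rewrite [X in _ + X](_ : _ = 0) ?addr0; first by apply: eq_bigr => i _; rewrite mulrC.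
  by rewrite -[RHS](s3b al be); apply: eq_bigr => i _; rewrite mulrC.
split.
- move=> al be ga; rewrite overlap_raise !e3 !part_raise.
  have -> : w be ga al = w al be ga.
    by have [_ -> _] := aw be al ga; have [-> _ _] := aw al be ga; rewrite opprK.
  have -> : s3 be ga al = s3 al be ga.
    by have [_ -> _] := ss3 be al ga; have [-> _ _] := ss3 al be ga.
  by rewrite (h_sym ga al) (h_sym be al); ring.
- move=> al be; rewrite j3b !e2 (ss2 al be).
  rewrite (_ : \sum_r w be al r * b r = - \sum_r w al be r * b r).
    set S := \sum_r _; transitivity (- ((2%:R^-1 + 2%:R^-1) * S)); first ring.
    by rewrite half mul1r.
  by rewrite -sumrN; apply: eq_bigr => r _; have [-> _ _] := aw al be r; rewrite mulNr.
- move=> al; under eq_bigr => i _ do rewrite e2 mulrDr mulrN mulrCA.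
  rewrite big_split /= sumrN -mulr_sumr.
  rewrite [X in _ + X](_ : _ = 0); last first.
    by rewrite -[RHS](s2b al); apply: eq_bigr => i _; rewrite mulrC.
  rewrite addr0 (_ : \sum_i _ = 0) ?mulr0 ?oppr0 //.
  by rewrite -[RHS](antisym3_contract b al aw); apply: eq_bigr => i _; rewrite mulrC.
- by rewrite -[RHS]s1b; apply: eq_bigr => i _; rewrite e1 mulrC.
Qed.

(** The b part is a particular solution of the degree 3 equation; the remainder t solves the
    homogeneous one, which says that t is invariant under cyclic permutations. *)
Lemma overlap_solution b : overlap_eqs b ->
  exists w s3 s2 s1, pbw_solution b w s3 s2 s1.
Proof.
case=> q3 q2 q1 q0.
pose t al be ga := j3 al be ga - \sum_r (h al r * h be ga - h al ga * h be r) * b r.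
have tcyc al be ga : t be ga al = t al be ga.
  apply/eqP; rewrite eq_sym -subr_eq0 /t; apply/eqP.
  have := q3 al be ga; rewrite overlap_raise !part_raise (h_sym ga al) (h_sym be al) => q.
  rewrite (_ : _ - _ = (j3 al be ga - j3 be ga al) -
    (raise b al * h be ga + raise b ga * h al be - 2%:R * raise b be * h al ga)).
    by rewrite q subrr.
  ring.
(* On a cyclic tensor the three transpositions act in the same way, so one of them is enough to
   antisymmetrise or symmetrise completely. *)
pose w al be ga := 2%:R^-1 * (t al be ga - t be al ga).
pose s3 al be ga := 2%:R^-1 * (t al be ga + t be al ga).
pose s2 al be := 2%:R^-1 * (j2 al be + j2 be al).
have tE al be ga : j3 al be ga =
    \sum_r (h al r * h be ga - h al ga * h be r) * b r + w al be ga + s3 al be ga.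
  rewrite -addrA /w /s3 -mulrDr addrACA addNr addr0 mulrDr -mulrDl half mul1r.
  by rewrite addrC subrK.
have aw : antisymmetric3 w.
  move=> x y z; rewrite /w !(tcyc y z x) !(tcyc x y z) !(tcyc x z y) !(tcyc y x z).
  by split; ring.
have ss : symmetric3 s3.
  move=> x y z; rewrite /s3 !(tcyc y z x) !(tcyc x y z) !(tcyc x z y) !(tcyc y x z).
  by split; ring.
have S2E al be : j2 al be = - (2%:R^-1 * \sum_r w al be r * b r) + s2 al be /\
    \sum_r s3 al be r * b r = 0.
  have j3b x y : \sum_i b i * j3 x y i =
      \sum_r w x y r * b r + \sum_r s3 x y r * b r.
    under eq_bigr => i _ do rewrite tE !mulrDr.
    rewrite !big_split /= part_contract add0r.
    by congr (_ + _); apply: eq_bigr => i _; rewrite mulrC.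
  have := q2 al be; have := q2 be al; rewrite !j3b.
  have -> : \sum_r w be al r * b r = - \sum_r w al be r * b r.
    rewrite -sumrN; apply: eq_bigr => r _.
    by have [-> _ _] := aw al be r; rewrite mulNr.
  have -> : \sum_r s3 be al r * b r = \sum_r s3 al be r * b r.
    by apply: eq_bigr => r _; have [-> _ _] := ss al be r.
  set W := \sum_r w al be r * b r; set S := \sum_r s3 al be r * b r => e' e.
  (* Add the degree 2 equations for (al, be) and (be, al): the left sides are opposite and W changes
     sign, which leaves [0 = - 2 S]. *)
  have S0 : S = 0.
    apply: (mulfI two_neq0); rewrite mulr0.
    transitivity (- ((j2 al be - j2 be al) + (j2 be al - j2 al be))); last by ring.
    by rewrite e e'; ring.
  split=> //; rewrite S0 addr0 in e.
  have -> : W = - (j2 al be - j2 be al) by rewrite e opprK.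
  transitivity ((2%:R^-1 + 2%:R^-1) * j2 al be); first by rewrite half mul1r.
  by rewrite /s2; ring.
exists w, s3, s2, j1; split=> //.
- by split=> // al be; have [] := S2E al be.
- split=> [al be|al]; first by rewrite /s2 [j2 be al + _]addrC.
  (* Contracting w twice with b gives zero, so the degree 1 equation reduces to the condition on
     s2. *)
  have := q1 al; under eq_bigr => i _ do rewrite (proj1 (S2E al i)) mulrDr mulrN mulrCA.
  rewrite big_split /= sumrN -mulr_sumr.
  rewrite [X in - (_ * X)](_ : _ = 0) ?mulr0 ?oppr0 ?add0r.
    by move=> e; rewrite -[RHS]e; apply: eq_bigr => i _; rewrite mulrC.
  by rewrite -[RHS](antisym3_contract b al aw); apply: eq_bigr => i _; rewrite mulrC.
- by rewrite -[RHS]q0; apply: eq_bigr => i _; rewrite mulrC.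
- by split=> // al be; have [] := S2E al be.
Qed.

End Equations.

(** * Coefficients of sums of commutators, and the low degrees of the ideal (R) *)

Section Coefficients.
Variables (K : fieldType) (s : nat) (T : free_alg K s) (h : 'M[K]_s.+1).
Local Notation I := 'I_s.+1.
Local Notation word := (word T).
Local Notation coef := (coef T).
Local Notation hcomp := (hcomp T).
Hypothesis symh : h^T = h.
Variables (j3 : I -> I -> I -> K) (j2 : I -> I -> K) (j1 : I -> K).

Definition low_part (r : I) : T :=
  (\sum_m \sum_n j3 m n r *: (word [:: m] * word [:: n]))
  + (\sum_l j2 l r *: word [:: l]) + j1 r *: (1 : T).

Lemma coef_mul_gen u i k (x : T) :
  coef (rcons u k) (x * word [:: i]) = (i == k)%:R * coef u x.
Proof.
elim/(free_ind T): x => [|c v x IH]; first by rewrite mul0r !raddf0 mulr0.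
rewrite mulrDl !fcoefD IH mulrDr -pzscalerAl !fcoefZ wordM !coef_word; congr (_ + _).
rewrite cats1 eqseq_rcons andbC; case: eqP => _ /=; by rewrite ?mul1r // mul0r mulr0.
Qed.

Lemma coef_gen_mul u i k (x : T) :
  coef (k :: u) (word [:: i] * x) = (i == k)%:R * coef u x.
Proof.
elim/(free_ind T): x => [|c v x IH]; first by rewrite mulr0 !raddf0 mulr0.
rewrite !mulrDr !fcoefD IH mulrDr -pzscalerAr !fcoefZ wordM !coef_word; congr (_ + _).
by rewrite /= eqseq_cons; case: eqP => _ /=; rewrite ?mul1r // mul0r mulr0.
Qed.

Lemma coef_nil_mul_gen i (x : T) : coef [::] (x * word [:: i]) = 0.
Proof.
elim/(free_ind T): x => [|c v x IH]; first by rewrite mul0r !raddf0.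
by rewrite mulrDl fcoefD IH -pzscalerAl fcoefZ wordM coef_word;
  case: v => [|? ?]; rewrite mulr0 addr0.
Qed.

Lemma coef_nil_gen_mul i (x : T) : coef [::] (word [:: i] * x) = 0.
Proof.
elim/(free_ind T): x => [|c v x IH]; first by rewrite mulr0 !raddf0.
by rewrite mulrDr fcoefD IH -pzscalerAr fcoefZ wordM coef_word mulr0 addr0.
Qed.

Lemma sum_delta (F : I -> K) k : \sum_i (i == k)%:R * F i = F k.
Proof.
rewrite (bigD1 k) //= eqxx mul1r big1 ?addr0 // => i /negbTE ->.
by rewrite mul0r.
Qed.

Definition commutator_sum (y : I -> T) : T :=
  \sum_i (y i * word [:: i] - word [:: i] * y i).

Lemma coef_commutator_nil y : coef [::] (commutator_sum y) = 0.
Proof.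
rewrite raddf_sum big1 // => i _.
by rewrite raddfB /= coef_nil_mul_gen coef_nil_gen_mul subr0.
Qed.

(** A word arises from [y_i x_i] only if i is its last letter, and from [x_i y_i] only if i is its
    first. *)
Lemma coef_commutator y a u : coef (a :: u) (commutator_sum y) =
  coef (belast a u) (y (last a u)) - coef u (y a).
Proof.
rewrite raddf_sum /=; under eq_bigr => i _ do
  rewrite raddfB /= coef_gen_mul lastI coef_mul_gen.
by rewrite sumrB !sum_delta.
Qed.

Lemma coef_low3 a b i : coef [:: a; b] (low_part i) = j3 a b i.
Proof.
rewrite /low_part !fcoefD fcoefZ -(word_nil T) coef_word mulr0 addr0.
rewrite [X in _ + X]raddf_sum /= [X in _ + X]big1 ?addr0; last first.
  by move=> l _; rewrite fcoefZ coef_word eqseq_cons andbF mulr0.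
rewrite raddf_sum /= -[RHS](sum_delta (fun a => j3 a b i)).
apply: eq_bigr => m _; rewrite raddf_sum /= -(sum_delta (fun b => j3 m b i)) mulr_sumr.
apply: eq_bigr => n _; rewrite fcoefZ wordM coef_word /= !eqseq_cons andbT.
by rewrite -mulnb natrM mulrC mulrA.
Qed.

Lemma coef_low2 a i : coef [:: a] (low_part i) = j2 a i.
Proof.
rewrite /low_part !fcoefD fcoefZ -(word_nil T) coef_word mulr0 addr0.
rewrite raddf_sum /= big1 ?add0r; last first.
  move=> l _; rewrite raddf_sum /= big1 // => n _.
  by rewrite fcoefZ wordM coef_word eqseq_cons andbF mulr0.
rewrite raddf_sum /= -[RHS](sum_delta (fun a => j2 a i)).
by apply: eq_bigr => m _; rewrite fcoefZ coef_word eqseq_cons andbT mulrC.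
Qed.

Lemma coef_low1 i : coef [::] (low_part i) = j1 i.
Proof.
rewrite /low_part !fcoefD fcoefZ -(word_nil T) coef_word mulr1.
rewrite raddf_sum /= big1 ?add0r; last first.
  move=> l _; rewrite raddf_sum /= big1 // => n _.
  by rewrite fcoefZ wordM coef_word mulr0.
rewrite raddf_sum /= big1 ?add0r // => l _.
by rewrite fcoefZ coef_word mulr0.
Qed.

Lemma low_part_deg i : deg_le 2 (low_part i).
Proof.
apply/deg_leP => m m2; rewrite /low_part !linearD !linear_sum -(word_nil T).
rewrite !big1 ?addr0.
- by rewrite linearZ /= hcomp_word (ltn_eqF (leq_trans _ m2)) // scale0r scaler0 addr0.
- by move=> l _; rewrite linearZ /= hcomp_word (ltn_eqF (leq_trans _ m2)) // scale0r scaler0.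
move=> l _; rewrite linear_sum big1 // => n _.
by rewrite linearZ /= wordM hcomp_word (ltn_eqF m2) scale0r scaler0.
Qed.

Lemma coef_ymW_deg u i : size u != 3%N -> coef u (ymW T h i) = 0.
Proof. by move=> su; rewrite -hcomp_ymW coef_hcomp (negbTE su). Qed.

(** The coefficient of abcd is the one of abc in [W^d] minus the one of bcd in [W^a]; by symmetry of
    h both are [h^ad h^bc + h^ab h^cd - 2 h^ac h^bd]. *)
Lemma ymW_commutator : commutator_sum (ymW T h) = 0.
Proof.
apply: coef_inj => -[|a u]; rewrite raddf0 ?coef_commutator_nil //.
rewrite coef_commutator //.
have [su|su] := eqVneq (size u) 3%N; last first.
  by rewrite !coef_ymW_deg ?size_belast // subr0.
case: u su => [//|b [//|c [//|d [|//]]]] _ /=.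
by rewrite !coef_ymW !(h_sym symh d); ring.
Qed.

(** Coefficients are compared by word length. In length 1 the left side is [j1 a - j1 a], in length
    0 it has no term, and beyond length 3 both sides vanish. *)
Lemma overlap_commutator c : overlap_eqs h j3 j2 j1 c <->
  commutator_sum low_part = \sum_i c i *: (ymW T h i - low_part i).
Proof.
have rhs u : coef u (\sum_i c i *: (ymW T h i - low_part i)) =
    \sum_i c i * (coef u (ymW T h i) - coef u (low_part i)).
  by rewrite raddf_sum /=; apply: eq_bigr => i _; rewrite fcoefZ raddfB.
have low0 u i : (2 < size u)%N -> coef u (low_part i) = 0.
  by move=> su; apply/eqP/negPn/negP => /low_part_deg; rewrite leqNgt su.
have rhs2 u : size u != 3%N ->
    \sum_i c i * (coef u (ymW T h i) - coef u (low_part i)) =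
    - \sum_i c i * coef u (low_part i).
  move=> su; rewrite -sumrN; apply: eq_bigr => i _.
  by rewrite coef_ymW_deg // sub0r mulrN.
have e1 : \sum_i c i * coef [::] (low_part i) = \sum_i c i * j1 i.
  by apply: eq_bigr => i _; rewrite coef_low1.
have e2 a : \sum_i c i * coef [:: a] (low_part i) = \sum_i c i * j2 a i.
  by apply: eq_bigr => i _; rewrite coef_low2.
have e3 a b : \sum_i c i * coef [:: a; b] (low_part i) = \sum_i c i * j3 a b i.
  by apply: eq_bigr => i _; rewrite coef_low3.
split=> [[q3 q2 q1 q0]|e].
  apply: coef_inj => u; rewrite rhs; case: u => [|a u].
    by rewrite coef_commutator_nil rhs2 // e1 q0 oppr0.
  rewrite coef_commutator; case: u => [|b [|d u]] /=.
  - by rewrite subrr rhs2 // e2 q1 oppr0.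
  - by rewrite !coef_low2 q2 rhs2 // e3.
  case: u => [|f u] /=.
    rewrite !coef_low3 q3; apply: eq_bigr => i _.
    by rewrite coef_ymW low0 // subr0.
  rewrite !low0 // subr0.
  by rewrite big1 // => i _; rewrite coef_ymW_deg // low0 // subr0 mulr0.
have E u : coef u (commutator_sum low_part) =
    \sum_i c i * (coef u (ymW T h i) - coef u (low_part i)) by rewrite e rhs.
split.
- move=> a b d; have := E [:: a; b; d]; rewrite coef_commutator /= !coef_low3 => ->.
  by apply: eq_bigr => i _; rewrite coef_ymW low0 // subr0.
- move=> a b; have := E [:: a; b].
  by rewrite coef_commutator /= !coef_low2 rhs2 // e3.
- move=> a; have := E [:: a]; rewrite coef_commutator /= subrr rhs2 // e2.
  by move/esym/eqP; rewrite oppr_eq0 => /eqP.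
- have := E [::]; rewrite coef_commutator_nil rhs2 // e1.
  by move/esym/eqP; rewrite oppr_eq0 => /eqP.
Qed.

(** The generators have degree 3, so the degree 3 part of [a y b] involves only the constant terms
    of a and b: in degree 3 the ideal is no larger than R. *)
Lemma ymW_ideal_low (X : T -> Prop) x :
  (forall y, X y -> exists c : I -> K, y = \sum_i c i *: ymW T h i) ->
  gen_ideal X x ->
  (forall n, (n < 3)%N -> hcomp n x = 0) /\
  exists c : I -> K, hcomp 3 x = \sum_i c i *: ymW T h i.
Proof.
move=> hX hx; apply: (hx (fun x => (forall n, (n < 3)%N -> hcomp n x = 0) /\
  exists c : I -> K, hcomp 3 x = \sum_i c i *: ymW T h i)); last first.
  move=> y /hX[c ->]; have e n : hcomp n (\sum_i c i *: ymW T h i) =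
      (n == 3)%:R *: \sum_i c i *: ymW T h i.
    rewrite linear_sum scaler_sumr; apply: eq_bigr => i _; rewrite linearZ /=.
    by rewrite -hcomp_ymW hcomp_hcomp !scalerA mulrC.
  split=> [n n3|]; first by rewrite e ltn_eqF // scale0r.
  by exists c; rewrite e eqxx scale1r.
split=> [|y z [hy [c ec]] [hz [d ed]]|a y b [hy [c ec]]].
- split=> [n _|]; first by rewrite linear0.
  by exists (fun=> 0); rewrite linear0 big1 // => i _; rewrite scale0r.
- split=> [n n3|]; first by rewrite linearD hy // hz // addr0.
  exists (fun i => c i + d i); rewrite linearD ec ed -big_split.
  by apply: eq_bigr => i _; rewrite scalerDl.
have low n m : (m <= n)%N -> (n < 3)%N -> hcomp m (a * y) = 0.
  move=> mn n3; rewrite hcompM big1 // => i _; rewrite [hcomp (m - i) y]hy ?mulr0 //.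
  by rewrite (leq_ltn_trans (leq_subr _ _)) // (leq_ltn_trans mn).
split=> [n n3|].
  by rewrite hcompM big1 // => i _; rewrite (low n) ?mul0r // -ltnS.
have hcomp0 z : hcomp 0 z = coef [::] z *: (1 : T).
  apply: coef_inj => u; rewrite coef_hcomp fcoefZ -(word_nil T) coef_word.
  by case: u => [|? ?]; rewrite ?mulr1 ?mulr0.
exists (fun i => coef [::] a * coef [::] b * c i).
rewrite hcompM big_ord_recr big1 ?add0r /= => [|i _]; last first.
  by rewrite (low i) ?mul0r.
rewrite hcompM big_ord_recl big1 ?addr0 /= => [|i _]; last first.
  by rewrite hy ?mulr0 // /bump ltnS; lia.
rewrite !hcomp0 ec -pzscalerAl mul1r -pzscalerAr mulr1 scalerA scaler_sumr.
by rewrite add0r; apply: eq_bigr => i _; rewrite scalerA [_ * coef _ a]mulrC.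
Qed.

Lemma leading_commutator (J : ideal T) (X : T -> Prop) :
  (forall y, X y -> exists c : I -> K, y = \sum_i c i *: ymW T h i) ->
  (forall i, J (ymW T h i - low_part i)) ->
  leading_property J X ->
  exists c : I -> K,
    commutator_sum low_part = \sum_i c i *: (ymW T h i - low_part i).
Proof.
move=> hX hJ L; have [J0 JD JM] := idealP J.
have JN x : J x -> J (- x) by rewrite -scaleN1r; apply: gen_idealZ.
(* The leading part of x lies in (R), which is zero below degree 3; dropping it lowers the degree
   until nothing is left. *)
have Jlow n x : (n < 3)%N -> deg_le n x -> J x -> x = 0.
  elim: n x => [|n IH] x n3 hx Jx.
    have [+ _] := ymW_ideal_low hX (L _ _ hx Jx).
    by move=> /(_ 0%N isT); rewrite (hcomp_sum hx) big_ord1 !hcomp_hcomp !eqxx !scale1r.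
  have [+ _] := ymW_ideal_low hX (L _ _ hx Jx).
  move=> /(_ _ n3); rewrite hcomp_hcomp eqxx scale1r => e.
  by apply: IH => //; [apply: ltnW | rewrite -[x]subr0 -e; apply: deg_le_top].
set y := commutator_sum low_part.
have Jy : J y.
  (* Subtracting the vanishing sum of the [[W^i, x_i]] exhibits y as a combination of multiples of
     the relations. *)
  have -> : y = \sum_i (word [:: i] * (ymW T h i - low_part i)
                        - (ymW T h i - low_part i) * word [:: i]).
    transitivity (y - commutator_sum (ymW T h)); first by rewrite ymW_commutator subr0.
    rewrite /y /commutator_sum -sumrB; apply: eq_bigr => i _.
    by rewrite mulrBr mulrBl !opprB addrACA [X in X + _]addrC addrACA.
  apply: ideal_sum => i _; apply: JD; last apply: JN.
    by have := JM (word [:: i]) _ 1 (hJ i); rewrite mulr1.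
  by have := JM 1 _ (word [:: i]) (hJ i); rewrite mul1r.
have y_deg : deg_le 3 y.
  rewrite /y /commutator_sum; elim/big_ind: _ => [|x z|i _].
  - exact: deg_le0.
  - exact: deg_leD.
  apply: deg_leD; last rewrite -scaleN1r; last apply: deg_leZ.
    by have := deg_le_words (a := [::]) (b := [:: i]) (@low_part_deg i); rewrite word_nil mul1r.
  by have := deg_le_words (a := [:: i]) (b := [::]) (@low_part_deg i); rewrite word_nil mulr1.
have [_ [c]] := ymW_ideal_low hX (L _ _ y_deg Jy).
rewrite hcomp_hcomp eqxx scale1r => e; exists c.
(* The coefficients c match the cubic part of y, so the difference of the two sides is an element of
   J of degree at most 2. *)
apply/eqP; rewrite -subr_eq0; apply/eqP; apply: (Jlow 2%N) => //; last first.
  apply: JD => //; apply: JN; apply: ideal_sum => i _; exact: gen_idealZ.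
have -> : y - \sum_i c i *: (ymW T h i - low_part i) =
    (y - hcomp 3 y) + \sum_i c i *: low_part i.
  rewrite e -addrA; congr (_ + _); rewrite -!sumrN -big_split.
  by apply: eq_bigr => i _; rewrite scalerBr opprB addrC.
apply: deg_leD; first exact: deg_le_top.
elim/big_ind: _ => [|x z|i _]; [exact: deg_le0 | exact: deg_leD |].
exact/deg_leZ/low_part_deg.
Qed.

End Coefficients.

Lemma overlap_leading (K : fieldType) (s : nat) (T : free_alg K s.+1)
    (h : 'M[K]_s.+2) j3 j2 j1 c n x :
  2%:R != 0 :> K -> h^T = h -> h \in unitmx -> overlap_eqs h j3 j2 j1 c ->
  gen_ideal (fun y : T => exists r, y = ymW T h r - low_part T j3 j2 j1 r) x ->
  deg_le n x ->
  gen_ideal (fun y : T => exists r, y = ymW T h r) (hcomp T n x).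
Proof.
move=> two_neq0 symh uh /(overlap_commutator T h) e.
(* The sign comes from [W^r - phi(W^r)]: the commutators with [W^r] sum to zero, so only those with
   [- phi(W^r)] remain. *)
apply: (@ymW_ideal_hcomp _ _ _ two_neq0 h _ (fun r => - c r)) => //.
  move=> i; rewrite addrC addKr -scaleN1r.
  exact/deg_leZ/low_part_deg.
transitivity (commutator_sum (ymW T h) - commutator_sum (low_part T j3 j2 j1)).
  rewrite -sumrB; apply: eq_bigr => i _.
  by rewrite mulrBr mulrBl !opprB addrACA [X in _ + X]addrC [LHS]addrACA.
rewrite ymW_commutator // sub0r e -sumrN.
by apply: eq_bigr => i _; rewrite scaleNr.
Qed.

(** * Transfer to the tensor algebra and to phi *)

Section TensorAlgebraPBW.
Variables (K : fieldType) (s : nat) (g : 'M[K]_s.+1).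
Variable phi : {linear YM_R g -> fil_piece (tensor_filtration K s) 2}.
Local Notation T := (tensor_free K s).
Local Notation X := (fun x : T => x \in YM_R_pred g).
Local Notation J := (YM_phi_ideal phi : ideal T).

Lemma YM_R_comb (y : T) :
  X y -> exists c : 'I_s.+1 -> K, y = \sum_i c i *: ymW T (invmx g) i.
Proof. by move=> /asboolP. Qed.

Lemma YM_phi_rel (x : YM_R g) : J (val x - fil_val (phi x)).
Proof. by apply: gen_ideal_gen; exists x. Qed.

Lemma YM_R_low (x : T) : X x -> exists n y,
  [/\ hcomp T n.+1 x = x, deg_le n y & J (x - y)].
Proof.
move=> xX; exists 2%N, (fil_val (phi (YMRel xX))); split.
- have [c ->] := YM_R_comb xX; rewrite linear_sum; apply: eq_bigr => i _.
  by rewrite linearZ /= hcomp_ymW.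
- by case: (phi _) => y /= /tensor_fil_coef.
- exact: (YM_phi_rel (YMRel xX)).
Qed.

Lemma YM_PBW_leading :
  YM_PBW phi <-> @leading_property K s T J X.
Proof.
have H := @pbw_leading K s T J (tensor_filtration K s) (@tensor_fil_coef K s) X
  YM_R_low (nabla_phi_fil phi).
by apply: iff_trans H; split=> -[f [fZ fg fbij]]; exists f.
Qed.

Variables (j3 : 'I_s.+1 -> 'I_s.+1 -> 'I_s.+1 -> K).
Variables (j2 : 'I_s.+1 -> 'I_s.+1 -> K) (j1 : 'I_s.+1 -> K).
Hypothesis phiE : forall r, fil_val (phi (YM_rel g r)) =
  (\sum_m \sum_n j3 m n r *: (nabla K m * nabla K n))
  + (\sum_l j2 l r *: nabla K l) + j1 r *: 1.
Local Notation low := (low_part T j3 j2 j1).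
Local Notation W := (ymW T (invmx g)).

Lemma phi_low r : fil_val (phi (YM_rel g r)) = low r.
Proof. exact: phiE. Qed.

Lemma YM_phi_gen r : J (W r - low r).
Proof. by rewrite -phi_low; apply: (YM_phi_rel (YM_rel g r)). Qed.

(** By linearity of phi, the relation attached to a combination of the [W^r] is the same combination
    of the relations attached to each [W^r]. *)
Lemma YM_phi_ideal_gen x : J x -> gen_ideal (fun y : T => exists r, y = W r - low r) x.
Proof.
apply: gen_ideal_sub => _ [y ->].
have [c ec] := YM_R_comb (valP y).
have ey : y = \sum_r c r *: YM_rel g r.
  by apply: val_inj; rewrite ec raddf_sum; apply: eq_bigr.
have ephi : val (phi y) = \sum_r c r *: low r.
  rewrite ey linear_sum raddf_sum; apply: eq_bigr => r _.
  by rewrite linearZ -phi_low.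
rewrite ec ephi -sumrB; apply: ideal_sum => r _; rewrite -scalerBr.
by apply: gen_idealZ; apply: gen_ideal_gen; exists r.
Qed.

End TensorAlgebraPBW.

Theorem theorem6 (K : fieldType) (s : nat) (g : 'M[K]_s.+1)
    (charK : 2%N \notin [pchar K])
    (g_sym : g^T = g) (g_nondeg : g \in unitmx)
    (phi : {linear YM_R g -> fil_piece (tensor_filtration K s) 2})
    (j3 : 'I_s.+1 -> 'I_s.+1 -> 'I_s.+1 -> K)
    (j2 : 'I_s.+1 -> 'I_s.+1 -> K) (j1 : 'I_s.+1 -> K)
    (phiE : forall r : 'I_s.+1, fil_val (phi (YM_rel g r)) =
      (\sum_m \sum_n j3 m n r *: (nabla K m * nabla K n))
      + (\sum_l j2 l r *: nabla K l) + j1 r *: 1) :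
  YM_PBW phi <->
  exists (b : 'I_s.+1 -> K)
      (w s3 : 'I_s.+1 -> 'I_s.+1 -> 'I_s.+1 -> K)
      (s2 : 'I_s.+1 -> 'I_s.+1 -> K) (s1 : 'I_s.+1 -> K),
    [/\ antisymmetric3 w,
        symmetric3 s3 /\ (forall al be, \sum_r s3 al be r * b r = 0),
        (forall al be, s2 be al = s2 al be) /\
          (forall al, \sum_r s2 al r * b r = 0),
        \sum_r s1 r * b r = 0
      & [/\ forall al be ga, j3 al be ga =
              \sum_r (invmx g al r * invmx g be ga
                      - invmx g al ga * invmx g be r) * b r
              + w al be ga + s3 al be ga,
            forall al be, j2 al be =
              - (2%:R^-1 * \sum_r w al be r * b r) + s2 al be
          & forall al, j1 al = s1 al]].
Proof.
have two_neq0 : 2%:R != 0 :> K by apply: contraNneq charK => e; apply/andP; rewrite e.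
have h_symm : (invmx g)^T = invmx g by rewrite trmx_inv g_sym.
have h_unit : invmx g \in unitmx by rewrite unitmx_inv.
apply: iff_trans (YM_PBW_leading phi) _; split=> [L|[b [w [s3 [s2 [s1 sol]]]]]].
  have [c ec] := leading_commutator h_symm (@YM_R_comb K s g) (YM_phi_gen phiE) L.
  by exists c; apply: (overlap_solution two_neq0 h_symm); apply/overlap_commutator; exact: ec.
have q := solution_overlap two_neq0 h_symm sol.
move=> n x hx /(YM_phi_ideal_gen phiE) Jx.
have sub (y : tensor_free K s) :
    gen_ideal (fun y => exists r, y = ymW (tensor_free K s) (invmx g) r) y ->
    gen_ideal (fun y : tensor_free K s => y \in YM_R_pred g) y.
  apply: gen_ideal_sub => _ [r ->]; apply: gen_ideal_gen; exact: YM_W_in.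
apply: sub.
(* For s = 0 the word 011 does not exist, but then every W^r vanishes. *)
case: s => [|s'] in g charK g_sym g_nondeg phi j3 j2 j1 phiE two_neq0 h_symm
  h_unit b w s3 s2 s1 sol q n x hx Jx *.
  have W0 r : ymW (tensor_free K 0) (invmx g) r = 0.
    apply: coef_inj => u; rewrite raddf0; have [su|su] := eqVneq (size u) 3%N; last first.
      by rewrite coef_ymW_deg.
    case: u su => [//|a [//|d [//|e [|//]]]] _; rewrite coef_ymW !ord1; ring.
  have low0 r : low_part (tensor_free K 0) j3 j2 j1 r = 0.
    (* Linearity of phi on R forces its value at [W^r = 0] to vanish, so the ideal of relations is
       zero. *)
    rewrite -(phi_low phiE) (_ : YM_rel g r = 0) ?linear0 //.
    by apply: val_inj; apply: W0.
  have -> : x = 0.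
    apply: (Jx (fun x => x = 0)) => [|_ [r ->]]; last by rewrite W0 low0 subr0.
    by split=> [//|_ _ -> ->|a _ e ->]; rewrite ?addr0 // mulr0 mul0r.
  rewrite linear0; set X := (X in gen_ideal X).
  by have [] := idealP (gen_ideal X).
exact: overlap_leading q Jx hx.
Qed.
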